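(* Let $\mathbb{K}$ be a field. For rank $3$ configurations, the numbers of equivalence classes for the different values of $r_W^2$ are $$|\Psi_3^3/_\simeq|=1,\quad|\Psi_3^4/_\simeq|=2,\quad|\Psi_3^5/_\simeq|=2,\quad|\Psi_3^6/_\simeq|=1.$$ Moreover, the equivalence classes of $\psi_W$ arising from configurations $W\subseteq\mathbb{K}^E$ with $r_W=3$ and $r_W^2=|E|$, given by a normalized configuration matrix $A=(I_3\mid A')$, are as follows, where $y_1,y_2,\dots$ are variables: (i) If $|E|=3$, then $\psi_W\simeq\det\begin{pmatrix} y_1 & 0 & 0 \\ 0 & y_2 & 0 \\ 0 & 0 & y_3 \end{pmatrix}$. (ii) If $|E|=4$ and $A'=(a_1,a_2,a_3)^\intercal$ with $a_i=0$ for exactly one $i$, then $\psi_W\simeq\det\begin{pmatrix} y_1 & y_4 & 0 \\ y_4 & y_2 & 0 \\ 0 & 0 & y_3 \end{pmatrix}$. (iii) If $|E|=4$ and $A'=(a_1,a_2,a_3)^\intercal$ with $a_i\ne0$ for all $i$, then $\psi_W\simeq\det\begin{pmatrix} y_1 & y_4 & y_4 \\ y_4 & y_2 & y_4 \\ y_4 & y_4 & y_3 \end{pmatrix}$. (iv) If $|E|=5$, $A'=(a_{i,j})\in\mathbb{K}^{3\times2}$, and exactly one pair of the three vectors $\begin{pmatrix} a_{i,1}a_{j,1} \\ a_{i,2}a_{j,2} \end{pmatrix}$, $i\ne j$, is linearly dependent, then $\psi_W\simeq\det\begin{pmatrix} y_1 & y_4 & y_5 \\ y_4 & y_2 & 0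 \\ y_5 & 0 & y_3 \end{pmatrix}$. (v) If $|E|=5$, $A'=(a_{i,j})\in\mathbb{K}^{3\times2}$, and all pairs of the three vectors $\begin{pmatrix} a_{i,1}a_{j,1} \\ a_{i,2}a_{j,2} \end{pmatrix}$, $i\ne j$, are linearly independent, then $\psi_W\simeq\det\begin{pmatrix} y_1 & y_4 & y_4+y_5 \\ y_4 & y_2 & y_5 \\ y_4+y_5 & y_5 & y_3 \end{pmatrix}$. (vi) If $|E|=6$, then $\psi_W\simeq\det\begin{pmatrix} y_1 & y_4 & y_6 \\ y_4 & y_2 & y_5 \\ y_6 & y_5 & y_3 \end{pmatrix}$.
   Context: For a finite set $E$, $\mathbb{K}^E$ is the $\mathbb{K}$-vector space with canonical basis $E$; for $w\in\mathbb{K}^E$, $w_e$ denotes its $e$-component. A configuration is a $\mathbb{K}$-linear subspace $W\subseteq\mathbb{K}^E$, of rank $r_W:=\dim_{\mathbb{K}}W$. A choice of basis $w^1,\dots,w^r$ of $W$ and an ordering of $E$ gives a configuration matrix $A=(w^i_j)_{i,j}\in\mathbb{K}^{r\times|E|}$ with row span $W$; it is normalized if $A=(I_r\mid A')$ with $I_r$ the unit matrix (always achievable after reordering $E$). The Hadamard product of $u,v\in\mathbb{K}^E$ is the componentwise product $u\star v=\sum_{e}u_ev_e\,e$; $W^{\star 2}$ is the linear span of all $u\star v$ with $u,v\in W$, and $r_W^2:=\dim_{\mathbb{K}}W^{\star2}$ (the superscript $2$ is an index, not a square). Configuration polynomial: for a basis $w^1,\dots,w^r$ of $W$ and variables $x=(x_e)_{e\in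 E}$, $\psi_W:=\det\left(\sum_{e\in E}x_e w^i_e w^j_e\right)_{1\le i,j\le r}\in\mathbb{K}[x]$; it is determined by $W$ up to a square factor in $\mathbb{K}^*$. (Linear contact) equivalence: for polynomials $\phi\in\mathbb{K}[x_1,\dots,x_m]$ and $\psi\in\mathbb{K}[x_1,\dots,x_n]$, $\phi\simeq\psi$ means that for some $p\ge m,n$ there are $\ell\in\operatorname{GL}_p(\mathbb{K})$ and $\lambda\in\mathbb{K}^*$ with $\phi=\lambda\cdot\psi\circ\ell$ in $\mathbb{K}[x_1,\dots,x_p]$. Configuration polynomials are compared by enumerating $E$ (the enumeration does not affect the equivalence class). $\Psi_r^d:=\{\psi_W\mid E\text{ finite set},\ W\subseteq\mathbb{K}^E\text{ a configuration},\ r_W=r,\ r_W^2=d\}$, and $\Psi_r^d/_\simeq$ is its set of equivalence classes.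
   Formalization: The count |Ψ_3^5/≃| = 2 is stated only for fields K with at least 4 elements; over the fields with 2 and 3 elements it is false, since a smooth conic has at most 4 points there and only the class in (iv) occurs. *)

(* Defs.v *)
From HB Require Import structures.
From mathcomp Require Import all_boot all_order all_algebra.
From mathcomp Require Import boolp classical_sets functions cardinality.
From mathcomp Require Import mpoly.

Set Implicit Arguments.
Unset Strict Implicit.
Unset Printing Implicit Defensive.
Import GRing.Theory.
Local Open Scope ring_scope.

Section Configurations.
Variables (K : fieldType) (E : finType).
Implicit Types (u v : {ffun E -> K^o}) (W U : {vspace {ffun E -> K^o}}).

Definition hadamard u v : {ffun E -> K^o} := [ffun e => u e * v e].

(* The span of all products u * v with u, v in W, in the style of [prodv]; the
   lemmas [hadamard_sq_mem] and [hadamard_sq_min] show that it is that span. *)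
Definition hadamard_sq W : {vspace {ffun E -> K^o}} :=
  <<allpairs hadamard (vbasis W) (vbasis W)>>%VS.

Lemma hadamard_sq_mem W u v :
  u \in W -> v \in W -> hadamard u v \in hadamard_sq W.
Proof.
move=> Wu Wv; rewrite (coord_vbasis Wu) (coord_vbasis Wv).
pose a i := coord (vbasis W) i u; pose b i := coord (vbasis W) i v.
have -> : hadamard (\sum_i a i *: (vbasis W)`_i) (\sum_j b j *: (vbasis W)`_j)
  = \sum_i \sum_j (a i * b j) *: hadamard (vbasis W)`_i (vbasis W)`_j.
  apply/ffunP=> e; rewrite ffunE !sum_ffunE mulr_suml.
  apply: eq_bigr => i _; rewrite sum_ffunE mulr_sumr.
  apply: eq_bigr => j _; rewrite !ffunE.
  by rewrite /GRing.scale /= mulrACA.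
apply: memv_suml => i _; apply: memv_suml => j _; apply: memvZ.
by apply/memv_span/allpairs_f; apply: mem_nth; rewrite size_tuple.
Qed.

Lemma hadamard_sq_min W U :
  (forall u v, u \in W -> v \in W -> hadamard u v \in U) ->
  (hadamard_sq W <= U)%VS.
Proof.
move=> WU; apply/span_subvP => _ /allpairsP[[u v] /= [Wu Wv ->]].
by apply: WU; apply: vbasis_mem.
Qed.

(* The variable x_e is ['X_(enum_rank e)]. *)
Definition config_poly r (w : r.-tuple {ffun E -> K^o}) : {mpoly K[#|E|]} :=
  \det (\matrix_(i, j) \sum_(e : E)
          (tnth w i e * tnth w j e) *: 'X_(enum_rank e)).

(* psi_W depends on the choice of a basis of W: [is_psi W f] says that f is
   psi_W for some basis. *)
Definition is_psi W (f : {mpoly K[#|E|]}) : Prop :=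
  exists2 w : (\dim W).-tuple {ffun E -> K^o}, basis_of W w & f = config_poly w.

(* s is the ordering of E. *)
Definition config_matrix W r n (s : 'I_n -> E) (A : 'M[K]_(r, n)) : Prop :=
  bijective s /\
  exists2 w : r.-tuple {ffun E -> K^o},
    basis_of W w & forall i j, A i j = tnth w i (s j).

Definition normalized_rank3 W m (s : 'I_(3 + m) -> E) (A' : 'M[K]_(3, m)) :=
  [/\ \dim W = 3%N, \dim (hadamard_sq W) = #|E|
    & config_matrix W s (row_mx 1%:M A')].

End Configurations.

Section Equivalence.
Variable K : fieldType.

Definition mwiden_le m p (h : (m <= p)%N) (f : {mpoly K[m]}) : {mpoly K[p]} :=
  f \mPo [tuple 'X_(widen_ord h i) | i < m].

Definition lin_subst p (l : 'M[K]_p) (f : {mpoly K[p]}) : {mpoly K[p]} :=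
  f \mPo [tuple \sum_(j < p) l i j *: 'X_j | i < p].

Definition contact_equiv m n (f : {mpoly K[m]}) (g : {mpoly K[n]}) : Prop :=
  exists p (hm : (m <= p)%N) (hn : (n <= p)%N) (l : 'M[K]_p) (c : K),
    [/\ l \in unitmx, c != 0
      & mwiden_le hm f = c *: lin_subst l (mwiden_le hn g)].

Definition polys := {n : nat & {mpoly K[n]}}.

Local Open Scope classical_set_scope.

Definition Psi (r d : nat) : set polys :=
  [set f | exists (E : finType) (W : {vspace {ffun E -> K^o}})
             (g : {mpoly K[#|E|]}),
     [/\ \dim W = r, \dim (hadamard_sq W) = d, is_psi W g
       & f = Tagged (fun n => {mpoly K[n]}) g]].

Definition Psi_classes (r d : nat) : set (set polys) :=
  [set [set g | Psi r d g /\ contact_equiv (tagged f) (tagged g)]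
     | f in Psi r d].

End Equivalence.

Arguments Psi K r d : clear implicits.
Arguments Psi_classes K r d : clear implicits.

Section NormalForms.
Variable K : fieldType.

(* y_k, numbered from 1, in n.+1 variables. *)
Definition y n (k : nat) : {mpoly K[n.+1]} := 'X_(inord k.-1).

Definition mx3 (R : nzRingType) (s : seq (seq R)) : 'M[R]_3 :=
  \matrix_(i < 3, j < 3) (nth [::] s i)`_j.

Definition nf1 : {mpoly K[3]} := let y := y 2 in
  \det (mx3 [:: [:: y 1; 0;   0  ];
                [:: 0;   y 2; 0  ];
                [:: 0;   0;   y 3]]).

Definition nf2 : {mpoly K[4]} := let y := y 3 in
  \det (mx3 [:: [:: y 1; y 4; 0  ];
                [:: y 4; y 2; 0  ];
                [:: 0;   0;   y 3]]).

Definition nf3 : {mpoly K[4]} := let y := y 3 in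
  \det (mx3 [:: [:: y 1; y 4; y 4];
                [:: y 4; y 2; y 4];
                [:: y 4; y 4; y 3]]).

Definition nf4 : {mpoly K[5]} := let y := y 4 in
  \det (mx3 [:: [:: y 1; y 4; y 5];
                [:: y 4; y 2; 0  ];
                [:: y 5; 0;   y 3]]).

Definition nf5 : {mpoly K[5]} := let y := y 4 in
  \det (mx3 [:: [:: y 1;       y 4; y 4 + y 5];
                [:: y 4;       y 2; y 5      ];
                [:: y 4 + y 5; y 5; y 3      ]]).

Definition nf6 : {mpoly K[6]} := let y := y 5 in
  \det (mx3 [:: [:: y 1; y 4; y 6];
                [:: y 4; y 2; y 5];
                [:: y 6; y 5; y 3]]).

(* The vector with entries a_{i,k} a_{j,k} is indexed by the element t of
   {0, 1, 2} that completes i and j. *)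
Definition pair_vec (A' : 'M[K]_(3, 2)) (t : 'I_3) : 'cV[K]_2 :=
  \col_k \prod_(i < 3 | i != t) A' i k.

Definition dependent_pairs (A' : 'M[K]_(3, 2)) : {set 'I_3 * 'I_3} :=
  [set q : 'I_3 * 'I_3 |
     (q.1 < q.2)%N && ~~ free [:: pair_vec A' q.1; pair_vec A' q.2]].

End NormalForms.

(* Main.v *)
Require Import Defs.
From HB Require Import structures.
From mathcomp Require Import all_boot all_order all_algebra.
From mathcomp Require Import boolp classical_sets functions cardinality.
From mathcomp Require Import mpoly.
From mathcomp Require Import ring.

Set Implicit Arguments.
Unset Strict Implicit.
Unset Printing Implicit Defensive.
Import GRing.Theory.
Local Open Scope ring_scope.

(* Up to a unit, psi_W is the determinant restricted to the span S of the
   matrices w_e w_e^T, and dim S = r_W^2.  In a basis u_0, u_1, u_2 of W that is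
   normalized at three elements of E, the squares u_i^2 contribute 3 to r_W^2,
   so r_W^2 - 3 is the dimension of the span of the three products u_i u_j.  The
   relations between these products, and a change of basis of W that puts them
   in standard form, give the list.  Equivalent polynomials are linear
   specializations of each other: nf2 vanishes on a hyperplane and nf4 on a
   subspace of codimension 2, and both properties pass to specializations.  But
   nf3 has no linear factor, and nf5, a Hankel determinant in other coordinates,
   does not vanish on any subspace of codimension 2. *)

(** * Linear substitutions *)

Section LinearSubstitution.
Variable K : fieldType.

(** Contact equivalence may add variables, so a normal form is compared with [f] through a
    surjective linear map instead of an invertible one: two pull-backs of the same polynomial become
    equivalent once there is room for both sets of variables. Inequivalence is proved for arbitrary
    substitutions, invertible or not. The obstacle is that [K] is arbitrary. Over a finite field the
    values at points of [K] do not determine a polynomial, so the test for linear factors of [nf3]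
    takes points with entries in [{poly K}]. For [nf5], points of [K] are enough as soon as [K] has
    a scalar other than 0 and 1. The Hankel coordinates come from a conic. The matrices of [nf5] are
    the symmetric [S] with [S_02 = S_01 + S_12]; for [S = p p^T] this is
    [p_0 p_2 = p_0 p_1 + p_1 p_2]. In a quadratic parametrization of this conic the entries of
    [p p^T] are polynomials of degree at most 4 in the parameter, and replacing its powers by
    independent variables gives matrices congruent to Hankel matrices. *)

Definition msubst m n (M : 'M[K]_(n, m)) (g : {mpoly K[n]}) : {mpoly K[m]} :=
  g \mPo [tuple \sum_(j < m) M i j *: 'X_j | i < n].

Lemma mmap_comp_mpoly (R : comNzRingType) (phi : {rmorphism K -> R}) m n
    (t : 'I_m -> R) (lq : n.-tuple {mpoly K[m]}) (g : {mpoly K[n]}) :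
  mmap phi t (g \mPo lq) = mmap phi (fun i => mmap phi t (tnth lq i)) g.
Proof.
rewrite comp_mpolyE raddf_sum /=; apply: eq_bigr => a _.
by rewrite mmapZ rmorph_prod; congr (_ * _); apply: eq_bigr => i _; rewrite rmorphXn.
Qed.

Lemma mmap_eq (R : comNzRingType) (phi : {rmorphism K -> R}) n
    (t u : 'I_n -> R) (g : {mpoly K[n]}) :
  t =1 u -> mmap phi t g = mmap phi u g.
Proof. by move=> tu; apply: eq_bigr => a _; rewrite (mmap1_eq a tu). Qed.

(** The ring [R] is left free on purpose: polynomial rings over [K] give composition of
    substitutions and points with polynomial entries, and [R = K] gives ordinary values. *)
Lemma mmap_msubst (R : comNzRingType) (phi : {rmorphism K -> R}) m n
    (t : 'I_m -> R) (M : 'M_(n, m)) (g : {mpoly K[n]}) :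
  mmap phi t (msubst M g) = mmap phi (fun i => \sum_j phi (M i j) * t j) g.
Proof.
rewrite mmap_comp_mpoly; apply: mmap_eq => i.
rewrite tnth_mktuple raddf_sum /=; apply: eq_bigr => j _.
by rewrite mmapZ mmapX mmap1U.
Qed.

Lemma msubstX m n (M : 'M_(n, m)) i : msubst M 'X_i = \sum_j M i j *: 'X_j.
Proof. by rewrite /msubst comp_mpolyXU -tnth_nth tnth_mktuple. Qed.

Lemma msubst_comp m n p (M : 'M_(n, m)) (N : 'M_(m, p)) (g : {mpoly K[n]}) :
  msubst N (msubst M g) = msubst (M *m N) g.
Proof.
rewrite {1}/msubst [LHS]mmap_msubst; apply: mmap_eq => i.
under eq_bigr => j _ do rewrite tnth_mktuple mul_mpolyC scaler_sumr.
rewrite exchange_big tnth_mktuple; apply: eq_bigr => k _.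
by rewrite mxE scaler_suml; apply: eq_bigr => j _; rewrite scalerA.
Qed.

Lemma msubst1 n (g : {mpoly K[n]}) : msubst 1%:M g = g.
Proof.
rewrite -[RHS]comp_mpoly_id; apply: mmap_eq => i; rewrite !tnth_mktuple.
rewrite (bigD1 i) //= mxE eqxx scale1r big1 ?addr0 // => j ji.
by rewrite mxE eq_sym (negbTE ji) scale0r.
Qed.

Lemma msubstZ m n (M : 'M_(n, m)) c (g : {mpoly K[n]}) :
  msubst M (c *: g) = c *: msubst M g.
Proof. exact: comp_mpolyZ. Qed.

Lemma mwiden_leE m p (h : (m <= p)%N) (f : {mpoly K[m]}) :
  mwiden_le h f = msubst (pid_mx m) f.
Proof.
apply: mmap_eq => i; rewrite !tnth_mktuple (bigD1 (widen_ord h i)) //=.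
rewrite mxE /= eqxx ltn_ord scale1r big1 ?addr0 // => j ji; rewrite mxE.
case: eqP => [ij|_]; last by rewrite scale0r.
by case/eqP: ji; apply: val_inj.
Qed.

Lemma lin_substE p (l : 'M_p) (f : {mpoly K[p]}) : lin_subst l f = msubst l f.
Proof. by []. Qed.

(* f is the pull-back of h, up to a unit, along a surjective linear map. *)
Definition pullback_of m d (h : {mpoly K[d]}) (f : {mpoly K[m]}) : Prop :=
  exists (M : 'M[K]_(d, m)) (c : K),
    [/\ row_free M, c != 0 & f = c *: msubst M h].

(** A one-sided weakening of contact equivalence: with no invertibility and no added variables, it
    composes by multiplying matrices. *)
Definition specializes m n (g : {mpoly K[n]}) (f : {mpoly K[m]}) : Prop :=
  exists (M : 'M[K]_(n, m)) (c : K), c != 0 /\ f = c *: msubst M g.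

Lemma pullback_of_refl d (h : {mpoly K[d]}) : pullback_of h h.
Proof.
exists 1%:M, 1; split; rewrite ?oner_neq0 // ?msubst1 ?scale1r //.
by rewrite row_free_unit unitmx1.
Qed.

(** In [m + n] variables both matrices become injections [A] and [B] of the same space [K^d]. Two
    such injections differ by an automorphism, which [complete_unitmx] extracts from
    [pinvmx B *m A]. *)
Lemma contact_equiv_pullback m n d (h : {mpoly K[d]}) (f : {mpoly K[m]})
    (g : {mpoly K[n]}) :
  pullback_of h f -> pullback_of h g -> contact_equiv f g.
Proof.
move=> [M [a [Mfree a0 ->]]] [N [b [Nfree b0 ->]]].
pose A := M *m (pid_mx m : 'M_(m, m + n)).
pose B := N *m (pid_mx n : 'M_(n, m + n)).
have rfree k (X : 'M[K]_(d, k)) (le_k : (k <= m + n)%N) :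
    row_free X -> row_free (X *m (pid_mx k : 'M_(k, m + n))).
  move=> /row_freeP[Y XY]; apply/row_freeP; exists (pid_mx k *m Y).
  by rewrite mulmxA -(mulmxA X) pid_mx_id // pid_mx_1 mulmx1.
have Afree : row_free A by apply: rfree; rewrite ?leq_addr.
have Bfree : row_free B by apply: rfree; rewrite ?leq_addl.
have BA : B *m (pinvmx B *m A) = A by rewrite mulmxA mulmxVp // mul1mx.
have [|l l_unit Al] := @complete_unitmx _ _ _ B (pinvmx B *m A).
  by rewrite BA (eqP Afree) (eqP Bfree).
exists (m + n)%N, (leq_addr n m), (leq_addl m n), l, (a / b); split => //.
  by rewrite mulf_neq0 ?invr_eq0.
rewrite !mwiden_leE lin_substE !msubstZ !msubst_comp.
by rewrite mulmxA -Al BA scalerA divfK.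
Qed.

Lemma contact_equiv_sym m n (f : {mpoly K[m]}) (g : {mpoly K[n]}) :
  contact_equiv f g -> contact_equiv g f.
Proof.
move=> [p [hm [hn [l [c [l_unit c0 eq_fg]]]]]].
exists p, hn, hm, (invmx l), c^-1.
split; [by rewrite unitmx_inv | by rewrite invr_eq0 |].
rewrite eq_fg !lin_substE msubstZ scalerA (mulVf c0) scale1r.
by rewrite msubst_comp mulmxV // msubst1.
Qed.

(** Setting the added variables to 0, by a matrix [pid_mx m], undoes the widening of [f]. *)
Lemma contact_equiv_specializes m n (f : {mpoly K[m]}) (g : {mpoly K[n]}) :
  contact_equiv f g -> specializes g f.
Proof.
move=> [p [hm [hn [l [c [l_unit c0 eq_fg]]]]]].
exists (pid_mx n *m l *m pid_mx m), c; split=> //.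
rewrite -!msubst_comp -msubstZ -mwiden_leE -lin_substE -eq_fg.
by rewrite mwiden_leE msubst_comp pid_mx_id // pid_mx_1 msubst1.
Qed.

Lemma specializes_trans m n p (f : {mpoly K[m]}) (g : {mpoly K[n]})
    (h : {mpoly K[p]}) :
  specializes g f -> specializes h g -> specializes h f.
Proof.
move=> [M [a [a0 ->]]] [N [b [b0 ->]]]; exists (N *m M), (a * b).
by rewrite mulf_neq0 // msubstZ msubst_comp scalerA.
Qed.

Lemma pullback_specializes m d (h : {mpoly K[d]}) (f : {mpoly K[m]}) :
  pullback_of h f -> specializes h f /\ specializes f h.
Proof.
move=> [M [c [/row_freeP[N MN] c0 ->]]]; split; first by exists M, c.
exists N, c^-1; rewrite invr_eq0 c0 msubstZ scalerA mulVf //.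
by rewrite msubst_comp MN msubst1 scale1r.
Qed.

End LinearSubstitution.

(** * Configuration polynomials *)

Section ConfigurationPolynomial.
Variables (K : fieldType) (E : finType).
Local Notation V := {ffun E -> K^o}.
Implicit Types (u v : V) (W U : {vspace V}).

Lemma hadamardC u v : hadamard u v = hadamard v u.
Proof. by apply/ffunP=> e; rewrite !ffunE mulrC. Qed.

Lemma hadamard_sum I J (r : seq I) (s : seq J) (a : I -> K) (b : J -> K)
    (u : I -> V) (v : J -> V) :
  hadamard (\sum_(i <- r) a i *: u i) (\sum_(j <- s) b j *: v j) =
  \sum_(i <- r) \sum_(j <- s) (a i * b j) *: hadamard (u i) (v j).
Proof.
apply/ffunP=> e; rewrite ffunE !sum_ffunE mulr_suml.
apply: eq_bigr => i _; rewrite sum_ffunE mulr_sumr.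
apply: eq_bigr => j _; rewrite !ffunE.
by rewrite /GRing.scale /= mulrACA.
Qed.

Lemma hadamard_sq_sub W U r (u : r.-tuple V) :
  basis_of W u ->
  (forall i j, hadamard (tnth u i) (tnth u j) \in U) ->
  (hadamard_sq W <= U)%VS.
Proof.
move=> Wu uU; apply: hadamard_sq_min => v w Wv Ww.
rewrite (coord_basis Wu Wv) (coord_basis Wu Ww) hadamard_sum.
apply: memv_suml => i _; apply: memv_suml => j _; apply: memvZ.
by have := uU i j; rewrite !(tnth_nth 0).
Qed.

(** An isomorphism from [K^E] to the linear forms. The entries of the matrix defining psi_W are the
    images of products of basis vectors, so they span a copy of [hadamard_sq W]. *)
Definition lform u : {mpoly K[#|E|]} := \sum_e u e *: 'X_(enum_rank e).

Lemma lformD u v : lform (u + v) = lform u + lform v.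
Proof. by rewrite -big_split; apply: eq_bigr => e _; rewrite ffunE scalerDl. Qed.

Lemma lformZ a u : lform (a *: u) = a *: lform u.
Proof. by rewrite scaler_sumr; apply: eq_bigr => e _; rewrite ffunE scalerA. Qed.

Lemma lform0 : lform 0 = 0.
Proof. by rewrite -(scale0r (0 : V)) lformZ scale0r. Qed.

Lemma lform_sum I (r : seq I) (F : I -> V) :
  lform (\sum_(i <- r) F i) = \sum_(i <- r) lform (F i).
Proof. exact: (big_morph lform lformD lform0). Qed.

Definition gram r (w : r.-tuple V) : 'M[{mpoly K[#|E|]}]_r :=
  \matrix_(i, j) lform (hadamard (tnth w i) (tnth w j)).

Lemma config_polyE r (w : r.-tuple V) : config_poly w = \det (gram w).
Proof.
congr (\det _); apply/matrixP=> i j; rewrite !mxE.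
by apply: eq_bigr => e _; rewrite ffunE.
Qed.

(** The Gram matrix changes by congruence with the transition matrix [P], so the scalar is the
    square of its determinant. The transition matrix [Q] in the other direction shows that this
    determinant is nonzero. *)
Lemma config_poly_basis W r (u w : r.-tuple V) :
  basis_of W u -> basis_of W w ->
  exists2 c : K, c != 0 & config_poly w = c *: config_poly u.
Proof.
move=> Wu Ww; pose P := \matrix_(i, k) coord u k (tnth w i).
pose Q := \matrix_(i, k) coord w k (tnth u i).
have Wt (x : r.-tuple V) i : basis_of W x -> tnth x i \in W.
  by move=> Wx; apply: (basis_mem Wx); apply: mem_tnth.
have wP i : tnth w i = \sum_k P i k *: tnth u k.
  rewrite [LHS](coord_basis Wu (Wt w i Ww)).
  by apply: eq_bigr => k _; rewrite mxE (tnth_nth 0 u).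
have uQ i : tnth u i = \sum_k Q i k *: tnth w k.
  rewrite [LHS](coord_basis Ww (Wt u i Wu)).
  by apply: eq_bigr => k _; rewrite mxE (tnth_nth 0 w).
have QP : Q *m P = 1%:M.
  apply/matrixP=> i j; rewrite !mxE.
  have uE : \sum_k (Q *m P) i k *: u`_k = u`_i.
    rewrite -[RHS]tnth_nth uQ; under [RHS]eq_bigr => k _ do rewrite wP scaler_sumr.
    rewrite exchange_big; apply: eq_bigr => k _; rewrite mxE scaler_suml.
    by apply: eq_bigr => l _; rewrite scalerA (tnth_nth 0).
  have := congr1 (coord u j) uE; rewrite coord_sum_free ?(basis_free Wu) // mxE => ->.
  by rewrite coord_free ?(basis_free Wu) // eq_sym.
exists (\det P ^+ 2).
  rewrite expf_neq0 //; apply/eqP => detP0.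
  have := congr1 determinant QP; rewrite det_mulmx detP0 mulr0 det1.
  by move/esym/eqP; rewrite oner_eq0.
have -> : config_poly w
  = \det (map_mx (@mpolyC _ _) P *m gram u *m (map_mx (@mpolyC _ _) P)^T).
  rewrite config_polyE; congr (\det _); apply/matrixP=> i j.
  rewrite !mxE !wP hadamard_sum lform_sum.
  under eq_bigr => k _ do rewrite lform_sum.
  rewrite exchange_big; apply: eq_bigr => l _.
  rewrite 2!mxE mulr_suml; apply: eq_bigr => k _.
  rewrite !mxE lformZ -mul_mpolyC mpolyCM; ring.
rewrite !det_mulmx det_tr -config_polyE det_map_mx -mul_mpolyC expr2 mpolyCM; ring.
Qed.

Definition coef_mx d (mu : d.-tuple V) : 'M[K]_(d, #|E|) :=
  \matrix_(k, j) tnth mu k (enum_val j).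

Lemma msubst_coef_mx d (mu : d.-tuple V) k :
  msubst (coef_mx mu) 'X_k = lform (tnth mu k).
Proof.
rewrite msubstX (reindex (@enum_rank E)) /=; last exact/onW_bij/enum_rank_bij.
by apply: eq_bigr => e _; rewrite mxE enum_rankK.
Qed.

Lemma coef_mx_free d (mu : d.-tuple V) : free mu -> row_free (coef_mx mu).
Proof.
move=> /freeP mu_free; apply: inj_row_free => c cmu.
apply/rowP=> k; rewrite [RHS]mxE; apply: (mu_free (c 0)).
apply/ffunP=> e; have /rowP/(_ (enum_rank e)) := cmu.
rewrite !mxE sum_ffunE ffunE => cmu_e; rewrite -[RHS]cmu_e; apply: eq_bigr => i _.
by rewrite ffunE mxE enum_rankK (tnth_nth 0).
Qed.

(** The [d] vectors of [mu] span a space that contains [hadamard_sq W], of dimension [d]. Hence they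
    are free, and sending the k-th variable to [lform] of the k-th vector is a pull-back. *)
Lemma is_psi_pullback W f r (u : r.-tuple V) d (mu : d.-tuple V)
    (N : 'M[{mpoly K[d]}]_r) :
  basis_of W u -> is_psi W f -> \dim (hadamard_sq W) = d ->
  (forall i j, hadamard (tnth u i) (tnth u j) \in <<mu>>%VS) ->
  (forall i j, msubst (coef_mx mu) (N i j)
             = lform (hadamard (tnth u i) (tnth u j))) ->
  pullback_of (\det N) f.
Proof.
move=> Wu [w Ww ->] dimW muW muN.
have er : r = \dim W by apply/esym; apply: vector.size_basis Wu.
case: _ / er w Ww => w Ww.
have [c c0 ->] := config_poly_basis Wu Ww.
exists (coef_mx mu), c; split=> //.
  apply: coef_mx_free; rewrite /free eqn_leq dim_span size_tuple -{1}dimW.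
  by rewrite dimvS // (hadamard_sq_sub Wu).
congr (_ *: _); rewrite config_polyE /msubst -det_map_mx.
by congr (\det _); apply/matrixP=> i j; rewrite !mxE -[LHS]muN.
Qed.

End ConfigurationPolynomial.

(** * Relations between products that produce each normal form *)

Section NormalFormCriteria.
Variables (K : fieldType) (E : finType).
Local Notation V := {ffun E -> K^o}.
Local Infix "**" := hadamard (at level 40).
Implicit Types (u v w : V) (W : {vspace V}).

Lemma msubst_y d (mu : d.+1.-tuple V) k :
  (k.-1 < d.+1)%N -> msubst (coef_mx mu) (y K d k) = lform mu`_k.-1.
Proof. by move=> kd; rewrite msubst_coef_mx (tnth_nth 0) inordK. Qed.

Lemma forall_ord3 (P : 'I_3 -> Prop) :
  P (inord 0) -> P (inord 1) -> P (inord 2) -> forall i, P i.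
Proof.
move=> P0 P1 P2 i; rewrite -(inord_val i).
by case: i => [[|[|[|//]]] lt_i].
Qed.

Lemma is_psi_pullback3 W f u v w d (mu : d.+1.-tuple V) (s : seq (seq {mpoly K[d.+1]})) :
  basis_of W [tuple u; v; w] -> is_psi W f -> \dim (hadamard_sq W) = d.+1 ->
  [/\ u ** u \in <<mu>>, v ** v \in <<mu>> & w ** w \in <<mu>>]%VS ->
  [/\ u ** v \in <<mu>>, u ** w \in <<mu>> & v ** w \in <<mu>>]%VS ->
  let S i j := msubst (coef_mx mu) (nth [::] s i)`_j in
  [/\ S 0%N 0%N = lform (u ** u), S 1%N 1%N = lform (v ** v) & S 2%N 2%N = lform (w ** w)] ->
  [/\ S 0%N 1%N = lform (u ** v), S 0%N 2%N = lform (u ** w) & S 1%N 2%N = lform (v ** w)] ->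
  [/\ S 1%N 0%N = lform (u ** v), S 2%N 0%N = lform (u ** w) & S 2%N 1%N = lform (v ** w)] ->
  pullback_of (\det (mx3 s)) f.
Proof.
move=> Wuvw psif dimW [uu vv ww] [uv uw vw] S [S00 S11 S22] [S01 S02 S12] [S10 S20 S21].
apply: (is_psi_pullback (mu := mu) Wuvw psif dimW).
  by apply: forall_ord3; apply: forall_ord3; rewrite !(tnth_nth 0) !inordK //= hadamardC.
apply: forall_ord3; apply: forall_ord3; rewrite !(tnth_nth 0) mxE !inordK //=;
  by rewrite 1?[RHS](congr1 _ (hadamardC _ _)).
Qed.

Lemma msubst0 d (mu : d.-tuple V) : msubst (coef_mx mu) 0 = 0.
Proof. exact: comp_mpoly0. Qed.

Lemma msubstD d (mu : d.-tuple V) f g :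
  msubst (coef_mx mu) (f + g) = msubst (coef_mx mu) f + msubst (coef_mx mu) g.
Proof. exact: comp_mpolyD. Qed.

Let y_simpl := (msubst_y, msubst0, msubstD, lformD, lform0).

Ltac span_mem := by rewrite ?mem0v ?memvD // memv_span // !inE eqxx ?orbT.

Variables (W : {vspace V}) (f : {mpoly K[#|E|]}) (u v w : V).
Hypotheses (Wuvw : basis_of W [tuple u; v; w]) (psif : is_psi W f).

(** Here and in the next five lemmas [mu] lists the products that take the places of y_1, y_2, ...:
    the three squares, then the mixed products that the relations leave. *)
Lemma pullback_nf1 : \dim (hadamard_sq W) = 3%N ->
  u ** v = 0 -> u ** w = 0 -> v ** w = 0 -> pullback_of (nf1 K) f.
Proof.
move=> dimW uv uw vw.
apply: (is_psi_pullback3 (mu := [tuple u ** u; v ** v; w ** w]) Wuvw) => //;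
  rewrite ?uv ?uw ?vw; split; rewrite /= ?y_simpl //; span_mem.
Qed.

Lemma pullback_nf2 : \dim (hadamard_sq W) = 4%N ->
  u ** w = 0 -> v ** w = 0 -> pullback_of (nf2 K) f.
Proof.
move=> dimW uw vw.
apply: (is_psi_pullback3 (mu := [tuple u ** u; v ** v; w ** w; u ** v]) Wuvw) => //;
  rewrite ?uw ?vw; split; rewrite /= ?y_simpl //; span_mem.
Qed.

Lemma pullback_nf3 : \dim (hadamard_sq W) = 4%N ->
  u ** w = u ** v -> v ** w = u ** v -> pullback_of (nf3 K) f.
Proof.
move=> dimW uw vw.
apply: (is_psi_pullback3 (mu := [tuple u ** u; v ** v; w ** w; u ** v]) Wuvw) => //;
  rewrite ?uw ?vw; split; rewrite /= ?y_simpl //; span_mem.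
Qed.

Lemma pullback_nf4 : \dim (hadamard_sq W) = 5%N ->
  v ** w = 0 -> pullback_of (nf4 K) f.
Proof.
move=> dimW vw.
apply: (is_psi_pullback3 (mu := [tuple u ** u; v ** v; w ** w; u ** v; u ** w]) Wuvw) => //;
  rewrite ?vw; split; rewrite /= ?y_simpl //; span_mem.
Qed.

Lemma pullback_nf5 : \dim (hadamard_sq W) = 5%N ->
  u ** w = u ** v + v ** w -> pullback_of (nf5 K) f.
Proof.
move=> dimW uw.
apply: (is_psi_pullback3 (mu := [tuple u ** u; v ** v; w ** w; u ** v; v ** w]) Wuvw) => //;
  rewrite ?uw; split; rewrite /= ?y_simpl //; span_mem.
Qed.

Lemma pullback_nf6 : \dim (hadamard_sq W) = 6%N -> pullback_of (nf6 K) f.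
Proof.
move=> dimW.
apply: (is_psi_pullback3
          (mu := [tuple u ** u; v ** v; w ** w; u ** v; v ** w; u ** w]) Wuvw) => //;
  split; rewrite /= ?y_simpl //; span_mem.
Qed.

End NormalFormCriteria.

(** * Classification *)

Section Normalization.
Variables (K : fieldType) (E : finType).
Local Notation V := {ffun E -> K^o}.
Local Infix "**" := hadamard (at level 40).
Implicit Types (u v w z : V) (W : {vspace V}).

Lemma hadamardE u v e : (u ** v) e = u e * v e.
Proof. by rewrite ffunE. Qed.

Lemma ffunZE a u e : (a *: u) e = a * u e :> K.
Proof. by rewrite ffunE. Qed.

Lemma ffunDE u v e : (u + v) e = u e + v e :> K.
Proof. by rewrite ffunE. Qed.

(** Three vectors that span a space of dimension 3 form a basis. Quantifying over all subspaces [U]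
    reduces spanning to closure properties of membership, with no coordinates. *)
Lemma basis_of3 W u v w u' v' w' :
  basis_of W [tuple u; v; w] ->
  [/\ u' \in W, v' \in W & w' \in W] ->
  (forall U : {vspace V}, u' \in U -> v' \in U -> w' \in U ->
    [/\ u \in U, v \in U & w \in U]) ->
  basis_of W [tuple u'; v'; w'].
Proof.
move=> Wuvw [Wu' Wv' Ww'] span_uvw; rewrite basisEdim (vector.size_basis Wuvw) andbT.
have [|||u_in v_in w_in] := span_uvw <<[:: u'; v'; w']>>%VS;
  rewrite ?memv_span ?inE ?eqxx ?orbT //.
by rewrite -(span_basis Wuvw); apply/span_subvP => x; rewrite !inE => /or3P[] /eqP->.
Qed.

Section Criteria.
Variables (W : {vspace V}) (f : {mpoly K[#|E|]}).
Hypothesis psif : is_psi W f.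

Lemma basis_of3_mem u v w :
  basis_of W [tuple u; v; w] -> [/\ u \in W, v \in W & w \in W].
Proof. by move=> Wuvw; split; apply: (basis_mem Wuvw); rewrite !inE eqxx ?orbT. Qed.

Lemma basis_of3_swap12 u v w :
  basis_of W [tuple u; v; w] -> basis_of W [tuple v; u; w].
Proof. by move=> Wuvw; have [] := basis_of3_mem Wuvw; move=> *; apply: basis_of3 Wuvw _ _. Qed.

Lemma basis_of3_swap23 u v w :
  basis_of W [tuple u; v; w] -> basis_of W [tuple u; w; v].
Proof. by move=> Wuvw; have [] := basis_of3_mem Wuvw; move=> *; apply: basis_of3 Wuvw _ _. Qed.

Lemma basis_of3_scale u v w a b c :
  basis_of W [tuple u; v; w] -> a != 0 -> b != 0 -> c != 0 ->
  basis_of W [tuple a *: u; b *: v; c *: w].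
Proof.
move=> Wuvw a0 b0 c0; have [Wu Wv Ww] := basis_of3_mem Wuvw.
apply: basis_of3 Wuvw _ _; first by split; apply: memvZ.
by move=> U; rewrite !rpredZeq (negbTE a0) (negbTE b0) (negbTE c0).
Qed.

Lemma nf2_criterion u v w z : basis_of W [tuple u; v; w] ->
  \dim (hadamard_sq W) = 4%N ->
  [/\ u ** v \in <[z]>%VS, u ** w \in <[z]>%VS & v ** w = 0] ->
  pullback_of (nf2 K) f.
Proof.
move=> Wuvw dimW [/vlineP[c uv] /vlineP[b uw] vw].
have [uw0|/eqP uw0] := eqVneq (u ** w) 0; first exact: (pullback_nf2 Wuvw).
(* Where z and u ** w do not vanish, neither do u, w, so v does. *)
suff uv0 : u ** v = 0.
  by apply: (pullback_nf2 (basis_of3_swap23 Wuvw)); rewrite // hadamardC.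
apply/ffunP=> e; rewrite [RHS]ffunE; apply/eqP/negPn/negP => uv_e.
have z_e : z e != 0.
  by apply: contraNneq uv_e => z_e; rewrite uv ffunZE z_e mulr0.
have uw_e : (u ** w) e != 0.
  rewrite uw ffunZE mulf_neq0 //; apply: contra_not_neq uw0 => b0.
  by rewrite uw b0 scale0r.
have /ffunP/(_ e) := vw; rewrite hadamardE [RHS]ffunE => /eqP.
move: uv_e uw_e; rewrite !hadamardE !mulf_eq0 !negb_or.
by move=> /andP[_ /negbTE->] /andP[_ /negbTE->].
Qed.

(** If [u ** v], [u ** w], [v ** w] are [c], [b], [a] times [z], then scaling [u], [v], [w] by [a],
    [b], [c] turns all three products into [abc] times [z]. *)
Lemma nf3_criterion u v w z : basis_of W [tuple u; v; w] ->
  \dim (hadamard_sq W) = 4%N ->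
  [/\ u ** v \in <[z]>%VS, u ** w \in <[z]>%VS & v ** w \in <[z]>%VS] ->
  u ** v != 0 -> u ** w != 0 -> v ** w != 0 ->
  pullback_of (nf3 K) f.
Proof.
move=> Wuvw dimW [/vlineP[c uv] /vlineP[b uw] /vlineP[a vw]].
rewrite uv uw vw !scaler_eq0 !negb_or => /andP[c0 _] /andP[b0 _] /andP[a0 _].
have E1 x y (i j k : K) : x ** y = k *: z -> (i *: x) ** (j *: y) = (i * j * k) *: z.
  move=> xy; apply/ffunP=> e; have /ffunP/(_ e) := xy.
  by rewrite !hadamardE !ffunZE => xy_e; rewrite mulrACA xy_e; ring.
apply: (pullback_nf3 (basis_of3_scale Wuvw a0 b0 c0)) => //;
  by rewrite (E1 _ _ _ _ _ uv) ?(E1 _ _ _ _ _ uw) ?(E1 _ _ _ _ _ vw); congr (_ *: _); ring.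
Qed.

(** The relation factors as [u ** x = 0] with [x = b *: w + c *: v]. The vector [x] replaces [w] in
    the basis if [b] is nonzero and [v] otherwise. *)
Lemma nf4_criterion u v w b c : basis_of W [tuple u; v; w] ->
  \dim (hadamard_sq W) = 5%N ->
  b *: (u ** w) + c *: (u ** v) = 0 -> (b != 0) || (c != 0) ->
  pullback_of (nf4 K) f.
Proof.
move=> Wuvw dimW rel bc.
have u0 : u ** (b *: w + c *: v) = 0.
  rewrite -rel; apply/ffunP=> e; rewrite !ffunE /GRing.scale /=; ring.
have [Wu Wv Ww] := basis_of3_mem Wuvw.
have Wx : b *: w + c *: v \in W by rewrite memvD ?memvZ.
case/orP: bc => [b0|c0].
  apply: (@pullback_nf4 _ _ W f v u (b *: w + c *: v)) => //.
  apply: basis_of3 Wuvw _ _ => // U Uv Uu Ux; split=> //.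
  have : b *: w + c *: v - c *: v \in U by rewrite memvB ?memvZ.
  by rewrite addrK rpredZeq (negbTE b0).
apply: (@pullback_nf4 _ _ W f w u (b *: w + c *: v)) => //.
apply: basis_of3 Wuvw _ _ => // U Uw Uu Ux; split=> //.
have : b *: w + c *: v - b *: w \in U by rewrite memvB ?memvZ.
by rewrite addrC addKr rpredZeq (negbTE c0).
Qed.

(** Division by [abc] shows that scaling [u], [v], [w] by the inverses of [a], [b], [c] makes all
    coefficients 1. The sign on [v] changes two of the three products and so puts the relation into
    the form required for [nf5]. *)
Lemma nf5_criterion u v w a b c : basis_of W [tuple u; v; w] ->
  \dim (hadamard_sq W) = 5%N ->
  a *: (v ** w) + b *: (u ** w) + c *: (u ** v) = 0 ->
  a != 0 -> b != 0 -> c != 0 ->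
  pullback_of (nf5 K) f.
Proof.
move=> Wuvw dimW rel a0 b0 c0.
have [a1 b1 c1] : [/\ a^-1 != 0, - b^-1 != 0 & c^-1 != 0].
  by rewrite oppr_eq0 !invr_eq0.
apply: (pullback_nf5 (basis_of3_scale Wuvw a1 b1 c1)) => //.
apply/ffunP=> e; have /ffunP/(_ e) := rel.
rewrite !ffunE /GRing.scale /= => rel_e.
have {rel_e} : u e * w e = - b^-1 * (a * (v e * w e) + c * (u e * v e)).
  apply: (mulfI b0); rewrite [RHS]mulrA mulrN divff // mulN1r.
  by apply/eqP; rewrite -subr_eq0 opprK addrCA addrA rel_e.
move=> uw_e; rewrite mulrACA uw_e; by field; rewrite a0 b0 c0.
Qed.

End Criteria.

End Normalization.

Lemma big_ord3 (R : Type) (idx : R) (op : Monoid.law idx) (F : 'I_3 -> R) :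
  \big[op/idx]_i F i = op (op (F (inord 0)) (F (inord 1))) (F (inord 2)).
Proof.
rewrite !big_ord_recl big_ord0 Monoid.mulm1 Monoid.mulmA.
by congr (op (op (F _) (F _)) (F _)); apply: val_inj; rewrite /= inordK.
Qed.

(** * Normalized bases and the dimension of the span of products *)

Section NormalizedBasis.
Variables (K : fieldType) (E : finType) (W : {vspace {ffun E -> K^o}}).
Local Notation V := {ffun E -> K^o}.
Local Infix "**" := hadamard (at level 40).

(** A 3-rowed matrix of rank 3 has an invertible minor [B] on three columns; multiplying the basis
    by [invmx B] normalizes it at these columns. *)
Lemma normalized_basis_exists : \dim W = 3%N ->
  exists (u : 3.-tuple V) (e : 'I_3 -> E),
    basis_of W u /\ forall i j, tnth u i (e j) = (i == j)%:R.
Proof.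
move=> dimW.
have [w Ww] : exists w : 3.-tuple V, basis_of W w.
  by rewrite -dimW; exists (vbasis W); apply: vbasisP.
have full_w : row_full (coef_mx w)^T.
  by rewrite /row_full mxrank_tr; apply/coef_mx_free/(basis_free Ww).
pose B := (rowsub (fullrankfun full_w) (coef_mx w)^T)^T.
have B_unit : B \in unitmx by rewrite unitmx_tr fullrowsub_unit.
pose e j := enum_val (fullrankfun full_w j).
have wB i j : tnth w i (e j) = B i j by rewrite !mxE.
pose u := [tuple \sum_k invmx B i k *: tnth w k | i < 3].
have ue i j : tnth u i (e j) = (i == j)%:R.
  transitivity ((invmx B *m B) i j); last by rewrite mulVmx // mxE.
  rewrite tnth_mktuple sum_ffunE mxE; apply: eq_bigr => k _.
  by rewrite ffunE wB.
exists u, e; split=> //; rewrite basisEfree dimW size_tuple leqnn andbT.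
apply/andP; split.
  apply/freeP => a /ffunP au i; have := au (e i).
  rewrite sum_ffunE [RHS]ffunE (bigD1 i) //= ffunZE.
  rewrite -(tnth_nth 0 u) ue eqxx mulr1 big1 ?addr0 // => j ji.
  by rewrite ffunZE -(tnth_nth 0 u) ue (negbTE ji) mulr0.
apply/span_subvP => x /tnthP[i ->]; rewrite tnth_mktuple.
by apply: memv_suml => k _; apply/memvZ/(basis_mem Ww)/mem_tnth.
Qed.

Section Cross.
Variables (u v w : V) (e : 'I_3 -> E).
Hypothesis Wuvw : basis_of W [tuple u; v; w].
Hypothesis uvw_e : forall i j, tnth [tuple u; v; w] i (e j) = (i == j)%:R.

(** The order matters: the t-th product omits the t-th basis vector, as in [pair_vec]. *)
Definition cross : seq V := [:: v ** w; u ** w; u ** v].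

Let uvw := [tuple u; v; w].
Let sq : 3.-tuple V := [tuple u ** u; v ** v; w ** w].

Let sq_e (a : 'I_3 -> K) j : (\sum_i a i *: sq`_i) (e j) = a j.
Proof.
have sqE (i : 'I_3) : sq`_i = tnth uvw i ** tnth uvw i.
  by move: i; apply: forall_ord3; rewrite !(tnth_nth 0) !inordK.
rewrite sum_ffunE (bigD1 j) //= ffunZE sqE hadamardE uvw_e eqxx !mulr1.
rewrite big1 ?addr0 // => i ij.
by rewrite ffunZE sqE hadamardE uvw_e (negbTE ij) !mulr0.
Qed.

Lemma cross_eval x j : x \in <<cross>>%VS -> x (e j) = 0.
Proof.
have uvw0 i k : i != k -> (tnth uvw i ** tnth uvw k) (e j) = 0.
  move=> ik; rewrite hadamardE !uvw_e; case: eqP => [ij|]; rewrite ?mul0r //.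
  by rewrite mul1r -ij eq_sym (negbTE ik).
move=> /(@coord_span _ _ _ (in_tuple cross)) ->; rewrite sum_ffunE big1 // => i _.
rewrite ffunZE; move: i; apply: forall_ord3; rewrite !inordK //=.
- by rewrite (uvw0 1 2) ?mulr0.
- by rewrite (uvw0 0 2) ?mulr0.
- by rewrite (uvw0 0 1) ?mulr0.
Qed.

(** At the three points [e j] the squares restrict to the unit vectors, whereas mixed products
    vanish. So the squares are free, and their span meets that of the mixed products only in 0. *)
Lemma dim_hadamard_sq : \dim (hadamard_sq W) = (3 + \dim <<cross>>)%N.
Proof.
have sq_free : free sq.
  by apply/freeP => a /ffunP a0 j; rewrite -sq_e a0 ffunE.
have [Wu Wv Ww] := basis_of3_mem Wuvw.
have -> : hadamard_sq W = (<<sq>> + <<cross>>)%VS.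
  apply/eqP; rewrite eqEsubv subv_add; apply/and3P; split.
  - apply: (hadamard_sq_sub Wuvw); apply: forall_ord3; apply: forall_ord3;
      rewrite !(tnth_nth 0) !inordK //= -span_cat memv_span //;
      by rewrite !inE ?eqxx ?orbT // hadamardC eqxx ?orbT.
  - apply/span_subvP => x; rewrite !inE.
    by case/or3P=> /eqP->; apply: hadamard_sq_mem.
  - apply/span_subvP => x; rewrite !inE.
    by case/or3P=> /eqP->; apply: hadamard_sq_mem.
rewrite dimv_disjoint_sum; first by rewrite (eqP sq_free).
apply/eqP; rewrite -subv0; apply/subvP => x; rewrite memv_cap memv0.
move=> /andP[x_sq x_cross]; rewrite (coord_span x_sq).
apply/eqP/big1 => j _; suff -> : coord sq j x = 0 by rewrite scale0r.
by rewrite -(sq_e (fun i => coord sq i x)) -(coord_span x_sq) cross_eval.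
Qed.

Let cross_mem x : x \in cross -> x \in <<cross>>%VS. Proof. exact: memv_span. Qed.

Lemma cross_dim3 : \dim (hadamard_sq W) = 3%N ->
  [/\ v ** w = 0, u ** w = 0 & u ** v = 0].
Proof.
rewrite dim_hadamard_sq => /eqP; rewrite -[X in _ == X]addn0 eqn_add2l dimv_eq0.
move=> /eqP cross0; split; apply/eqP; rewrite -memv0 -cross0 cross_mem //;
by rewrite !inE eqxx ?orbT.
Qed.

Lemma cross_dim4 : \dim (hadamard_sq W) = 4%N ->
  exists z, [/\ u ** v \in <[z]>%VS, u ** w \in <[z]>%VS & v ** w \in <[z]>%VS].
Proof.
rewrite dim_hadamard_sq => /eqP; rewrite -[X in _ == X](addn1 3) eqn_add2l.
move=> /eqP cross1; exists (vpick <<cross>>%VS).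
have -> : <[vpick <<cross>>]>%VS = <<cross>>%VS.
  apply/eqP; rewrite eqEdim -memvE memv_pick cross1 dim_vline vpick0 -dimv_eq0.
  by rewrite cross1.
by split; apply: cross_mem; rewrite !inE eqxx ?orbT.
Qed.

Lemma cross_dim5 : \dim (hadamard_sq W) = 5%N ->
  exists a b c, [|| a != 0, b != 0 | c != 0] /\
    a *: (v ** w) + b *: (u ** w) + c *: (u ** v) = 0.
Proof.
rewrite dim_hadamard_sq => /eqP; rewrite (eqn_add2l 3 _ 2) => /eqP cross2.
apply: contrapT => no_rel.
suff : free cross by rewrite /free cross2.
apply/(@freeP _ _ _ (in_tuple cross)) => k; rewrite big_ord3 !inordK //= => rel.
suff [k0 k1 k2] : [/\ k (inord 0) = 0, k (inord 1) = 0 & k (inord 2) = 0].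
  exact: forall_ord3.
have := contra_notN _ no_rel.
move=> /(_ [|| k (inord 0) != 0, k (inord 1) != 0 | k (inord 2) != 0]).
rewrite !negb_or !negbK => /(_ _)/and3P[|/eqP ? /eqP ? /eqP ?] // nz.
by exists (k (inord 0)), (k (inord 1)), (k (inord 2)).
Qed.

Lemma dim_hadamard_sq_bounds : (3 <= \dim (hadamard_sq W) <= 6)%N.
Proof.
by rewrite dim_hadamard_sq leq_addr (leq_add2l 3 _ 3) (dim_span cross).
Qed.

End Cross.

End NormalizedBasis.

Section Classification.
Variables (K : fieldType) (E : finType) (W : {vspace {ffun E -> K^o}}).
Variable f : {mpoly K[#|E|]}.
Hypothesis psif : is_psi W f.
Local Notation V := {ffun E -> K^o}.
Local Infix "**" := hadamard (at level 40).
Implicit Types u v w : V.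

Lemma nf2_of_zero u v w z : basis_of W [tuple u; v; w] ->
  \dim (hadamard_sq W) = 4%N ->
  [/\ u ** v \in <[z]>%VS, u ** w \in <[z]>%VS & v ** w \in <[z]>%VS] ->
  [\/ v ** w = 0, u ** w = 0 | u ** v = 0] -> pullback_of (nf2 K) f.
Proof.
move=> Wuvw dimW [uv uw vw] [] zero.
- by apply: (nf2_criterion psif Wuvw dimW); split; eassumption.
- apply: (nf2_criterion psif (basis_of3_swap12 Wuvw) dimW).
  by split; [rewrite hadamardC; apply: uv | apply: vw |].
- apply: (nf2_criterion psif (basis_of3_swap12 (basis_of3_swap23 Wuvw)) dimW).
  by split; [rewrite hadamardC; apply: uw | rewrite hadamardC; apply: vw |].
Qed.

Lemma nf4_of_relation u v w a b c : basis_of W [tuple u; v; w] ->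
  \dim (hadamard_sq W) = 5%N ->
  a *: (v ** w) + b *: (u ** w) + c *: (u ** v) = 0 ->
  [|| a != 0, b != 0 | c != 0] -> [|| a == 0, b == 0 | c == 0] ->
  pullback_of (nf4 K) f.
Proof.
move=> Wuvw dimW rel nz /or3P[] /eqP z0; move: rel nz; rewrite z0 scale0r eqxx.
- by rewrite add0r; apply: (nf4_criterion psif Wuvw dimW).
- rewrite addr0 (hadamardC u v).
  exact: (nf4_criterion psif (basis_of3_swap12 Wuvw) dimW).
- rewrite addr0 orbF (hadamardC u w) (hadamardC v w).
  exact: (nf4_criterion psif (basis_of3_swap12 (basis_of3_swap23 Wuvw)) dimW).
Qed.

Hypothesis dimW : \dim W = 3%N.

Lemma basis_triple (u : 3.-tuple V) : exists u0 u1 u2, u = [tuple u0; u1; u2].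
Proof.
case: u => -[|u0 [|u1 [|u2 [|]]]] // sz; exists u0, u1, u2.
exact: val_inj.
Qed.

Lemma classify3 : \dim (hadamard_sq W) = 3%N -> pullback_of (nf1 K) f.
Proof.
move=> d3; have [u [e [Wu ue]]] := normalized_basis_exists dimW.
have [u0 [u1 [u2 def_u]]] := basis_triple u; move: Wu ue; rewrite {}def_u => Wu ue.
have [u12 u02 u01] := cross_dim3 Wu ue d3.
exact: (pullback_nf1 Wu).
Qed.

Lemma classify4 : \dim (hadamard_sq W) = 4%N ->
  pullback_of (nf2 K) f \/ pullback_of (nf3 K) f.
Proof.
move=> d4; have [u [e [Wu ue]]] := normalized_basis_exists dimW.
have [u0 [u1 [u2 def_u]]] := basis_triple u; move: Wu ue; rewrite {}def_u => Wu ue.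
have [z zP] := cross_dim4 Wu ue d4.
have [|u12] := eqVneq (u1 ** u2) 0.
  by move=> zero; left; apply: (nf2_of_zero Wu d4 zP); constructor.
have [|u02] := eqVneq (u0 ** u2) 0.
  by move=> zero; left; apply: (nf2_of_zero Wu d4 zP); constructor.
have [|u01] := eqVneq (u0 ** u1) 0.
  by move=> zero; left; apply: (nf2_of_zero Wu d4 zP); constructor.
by right; apply: (nf3_criterion psif Wu d4 zP).
Qed.

Lemma classify5 : \dim (hadamard_sq W) = 5%N ->
  pullback_of (nf4 K) f \/ pullback_of (nf5 K) f.
Proof.
move=> d5; have [u [e [Wu ue]]] := normalized_basis_exists dimW.
have [u0 [u1 [u2 def_u]]] := basis_triple u; move: Wu ue; rewrite {}def_u => Wu ue.
have [a [b [c [nz rel]]]] := cross_dim5 Wu ue d5.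
case: (boolP [|| a == 0, b == 0 | c == 0]) => [zero|].
  by left; apply: (nf4_of_relation Wu d5 rel).
rewrite !negb_or => /and3P[a0 b0 c0].
by right; apply: (nf5_criterion psif Wu d5 rel).
Qed.

Lemma classify6 : \dim (hadamard_sq W) = 6%N -> pullback_of (nf6 K) f.
Proof.
move=> d6; have [u [e [Wu ue]]] := normalized_basis_exists dimW.
have [u0 [u1 [u2 def_u]]] := basis_triple u; move: Wu ue; rewrite {}def_u => Wu ue.
exact: (pullback_nf6 Wu).
Qed.

End Classification.

(** * Inequivalent normal forms *)

Section NonEquivalence.
Variable K : fieldType.

Lemma det3 (R : comNzRingType) (s : seq (seq R)) :
  let a i j := (nth [::] s i)`_j in
  \det (mx3 s) = a 0%N 0%N * (a 1%N 1%N * a 2%N 2%N - a 1%N 2%N * a 2%N 1%N)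
               - a 0%N 1%N * (a 1%N 0%N * a 2%N 2%N - a 1%N 2%N * a 2%N 0%N)
               + a 0%N 2%N * (a 1%N 0%N * a 2%N 1%N - a 1%N 1%N * a 2%N 0%N).
Proof.
move=> a; rewrite (expand_det_row _ 0) !big_ord_recl big_ord0 addr0 /cofactor.
rewrite !(expand_det_row _ 0) !big_ord_recl !big_ord0 !addr0 /cofactor !det_mx11 !mxE /=.
rewrite -!/(a _ _); ring.
Qed.

Lemma mmap_y (R : comNzRingType) (phi : {rmorphism K -> R}) n (t : 'I_n.+1 -> R) k :
  mmap phi t (y K n k) = t (inord k.-1).
Proof. by rewrite mmapX mmap1U. Qed.

Lemma nf2_eval (R : comNzRingType) (phi : {rmorphism K -> R}) t :
  let x k := t (inord k) in
  mmap phi t (nf2 K) = x 2%N * (x 0%N * x 1%N - x 3%N ^+ 2).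
Proof.
rewrite /nf2 det3 /= !(rmorphB, rmorphD, rmorphM, rmorph0) /= !mmap_y /=; ring.
Qed.

Lemma nf3_eval (R : comNzRingType) (phi : {rmorphism K -> R}) t :
  let x k := t (inord k) in
  mmap phi t (nf3 K) = x 0%N * x 1%N * x 2%N + x 3%N ^+ 3 *+ 2
    - x 3%N ^+ 2 * (x 0%N + x 1%N + x 2%N).
Proof.
rewrite /nf3 det3 /= !(rmorphB, rmorphD, rmorphM, rmorph0) /= !mmap_y /=; ring.
Qed.

Lemma nf4_eval (R : comNzRingType) (phi : {rmorphism K -> R}) t :
  let x k := t (inord k) in
  mmap phi t (nf4 K) = x 0%N * x 1%N * x 2%N - x 3%N ^+ 2 * x 2%N - x 4%N ^+ 2 * x 1%N.
Proof.
rewrite /nf4 det3 /= !(rmorphB, rmorphD, rmorphM, rmorph0) /= !mmap_y /=; ring.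
Qed.

Lemma nf5_eval (R : comNzRingType) (phi : {rmorphism K -> R}) t :
  let x k := t (inord k) in
  mmap phi t (nf5 K) =
    x 0%N * (x 1%N * x 2%N - x 4%N ^+ 2) - x 3%N * (x 3%N * x 2%N - x 4%N * (x 3%N + x 4%N))
    + (x 3%N + x 4%N) * (x 3%N * x 4%N - x 1%N * (x 3%N + x 4%N)).
Proof.
rewrite /nf5 det3 /= !(rmorphB, rmorphD, rmorphM, rmorph0) /= !mmap_y /=; ring.
Qed.

Lemma big_ord_inord (R : nmodType) n (F : 'I_n.+1 -> R) :
  \sum_i F i = \sum_(0 <= i < n.+1) F (inord i).
Proof. by rewrite big_mkord; apply: eq_bigr => i _; rewrite inord_val. Qed.

(** Points over [K] would not do: over the field with two elements, [nf3] is zero at every rational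
    point of the hyperplane [x1 + x2 + x3 = 0]. *)
Lemma nf3_not_divisible (m1 m2 m3 m4 : K) : m1 != 0 ->
  ~ forall x1 x2 x3 x4 : {poly K},
      m1%:P * x1 + m2%:P * x2 + m3%:P * x3 + m4%:P * x4 = 0 ->
      x1 * x2 * x3 + x4 ^+ 3 *+ 2 - x4 ^+ 2 * (x1 + x2 + x3) = 0.
Proof.
move=> m1_neq0 vanish; pose n i := - (i / m1).
(* Eliminate x1; the points (x2, x3, x4) = ('X, 1, 0) and ('X, 0, 1) suffice. *)
have {}vanish (x2 x3 x4 : {poly K}) :
    let x1 := (n m2)%:P * x2 + (n m3)%:P * x3 + (n m4)%:P * x4 in
    x1 * x2 * x3 + x4 ^+ 3 *+ 2 - x4 ^+ 2 * (x1 + x2 + x3) = 0.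
  apply: vanish; have nE i : m1%:P * (n i)%:P = - i%:P.
    by rewrite -polyCM /n mulrN mulrC divfK // polyCN.
  by rewrite !mulrDr !mulrA !nE; ring.
have [n2 n3] : n m2 = 0 /\ n m3 = 0.
  have /eqP := vanish 'X 1 0.
  rewrite !(mulr0, mulr1, addr0, expr0n, mul0r, mul0rn, subr0) /=.
  rewrite mulf_eq0 polyX_eq0 orbF => /eqP n23.
  have n3 : n m3 = 0 by have := congr1 (horner^~ 0) n23; rewrite !hornerE.
  by have := congr1 (horner^~ 1) n23; rewrite !hornerE n3 addr0.
(* The equation is now [2 - n m4 - 'X = 0], refuted by comparing its values at 0 and 1. *)
have := vanish 'X 0 1; rewrite n2 n3 => eq0.
have := congr1 (horner^~ 0) eq0; have := congr1 (horner^~ 1) eq0.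
rewrite !hornerE => e1 e0; have /eqP := oner_neq0 K; apply.
have /= := congr2 (fun a b => a - b) e0 e1; rewrite subr0 => <-; ring.
Qed.

(** The form with coefficients [m] is substituted for y_3, a factor of [nf2]. By the symmetry of
    [nf3] in its first three variables, any of the first three coefficients can play the role of
    [m1] above. If all three are 0, the form vanishes at (1, 1, 1, 0), where [nf3] is 1. *)
Lemma nf3_not_specializes_nf2 : ~ specializes (nf2 K) (nf3 K).
Proof.
move=> [M [c [_ eq_nf]]].
pose m k := M (inord 2) (inord k).
have vanish (x1 x2 x3 x4 : {poly K}) :
    (m 0%N)%:P * x1 + (m 1%N)%:P * x2 + (m 2%N)%:P * x3 + (m 3%N)%:P * x4 = 0 ->
    x1 * x2 * x3 + x4 ^+ 3 *+ 2 - x4 ^+ 2 * (x1 + x2 + x3) = 0.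
  move=> mx; pose t (i : 'I_4) := [:: x1; x2; x3; x4]`_i.
  have := congr1 (mmap (@polyC K) t) eq_nf.
  rewrite nf3_eval mmapZ mmap_msubst nf2_eval /= /t !inordK //= => ->.
  rewrite big_ord_inord !big_nat_recr //= big_nil add0r !inordK //=.
  by rewrite mx mul0r mulr0.
have [m0|] := eqVneq (m 0%N) 0; last first.
  by move/nf3_not_divisible; apply; apply: vanish.
have [m1|] := eqVneq (m 1%N) 0; last first.
  move/nf3_not_divisible => /(_ (m 0%N) (m 2%N) (m 3%N)); apply=> x1 x2 x3 x4 mx.
  by rewrite -(vanish x2 x1 x3 x4) -?mx; ring.
have [m2|] := eqVneq (m 2%N) 0; last first.
  move/nf3_not_divisible => /(_ (m 1%N) (m 0%N) (m 3%N)); apply=> x1 x2 x3 x4 mx.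
  by rewrite -(vanish x3 x2 x1 x4) -?mx; ring.
have := vanish 1 1 1 0; rewrite m0 m1 m2 !mul0r mulr0 !addr0 => /(_ erefl).
by rewrite !expr0n !mul0r mul0rn subr0 addr0 !mulr1 => /eqP; rewrite oner_eq0.
Qed.

Lemma common_zero3 (a b : 'I_3 -> K) :
  exists x y z : K, [/\ [|| x != 0, y != 0 | z != 0],
    a (inord 0) * x + a (inord 1) * y + a (inord 2) * z = 0
  & b (inord 0) * x + b (inord 1) * y + b (inord 2) * z = 0].
Proof.
pose M : 'M[K]_(3, 2) := \matrix_(i, j) (if j == 0 then a i else b i).
have kerM : kermx M != 0.
  by rewrite -mxrank_eq0 mxrank_ker -lt0n subn_gt0 (leq_ltn_trans (rank_leq_col M)).
pose v := nz_row (kermx M).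
have vM : v *m M = 0 by apply/sub_kermxP/nz_row_sub.
have v_neq0 : v != 0 by rewrite nz_row_eq0.
exists (v 0 (inord 0)), (v 0 (inord 1)), (v 0 (inord 2)); split.
- apply: contraNT v_neq0; rewrite !negb_or !negbK => /and3P[/eqP v0 /eqP v1 /eqP v2].
  by apply/eqP/rowP; apply: forall_ord3; rewrite mxE.
- have /rowP/(_ 0) := vM; rewrite !mxE big_ord3 !mxE /= => <-; ring.
- have /rowP/(_ 1) := vM; rewrite !mxE big_ord3 !mxE /= => <-; ring.
Qed.

(** The determinant of the 3 by 3 matrix with entries h_{i+j}, indices starting at 0. *)
Definition hankel (h0 h1 h2 h3 h4 : K) :=
  h0 * h2 * h4 + h1 * h2 * h3 *+ 2 - h2 ^+ 3 - h0 * h3 ^+ 2 - h1 ^+ 2 * h4.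

(* A subspace T of codimension 2 meets every coordinate subspace of dimension 3.
   The planes h0 = h1 = 0 and h3 = h4 = 0 show that T contains the coordinate
   vectors 0 and 4, or 1 and 3; a third vector of T then has to be 0. *)
Lemma hankel_not_in_two_forms (c : K) (a b : 'I_5 -> K) : c != 0 -> c != 1 ->
  let form (d : 'I_5 -> K) h0 h1 h2 h3 h4 :=
    d (inord 0) * h0 + d (inord 1) * h1 + d (inord 2) * h2
    + d (inord 3) * h3 + d (inord 4) * h4 in
  ~ forall h0 h1 h2 h3 h4, form a h0 h1 h2 h3 h4 = 0 ->
      form b h0 h1 h2 h3 h4 = 0 -> hankel h0 h1 h2 h3 h4 = 0.
Proof.
move=> c0 c1 form vanish.
pose T h0 h1 h2 h3 h4 := form a h0 h1 h2 h3 h4 = 0 /\ form b h0 h1 h2 h3 h4 = 0.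
have {}vanish h0 h1 h2 h3 h4 : T h0 h1 h2 h3 h4 -> hankel h0 h1 h2 h3 h4 = 0.
  by case; apply: vanish.
have Tlin i j s0 s1 s2 s3 s4 t0 t1 t2 t3 t4 : T s0 s1 s2 s3 s4 -> T t0 t1 t2 t3 t4 ->
    T (i * s0 + j * t0) (i * s1 + j * t1) (i * s2 + j * t2) (i * s3 + j * t3)
      (i * s4 + j * t4).
  have formD d : form d (i * s0 + j * t0) (i * s1 + j * t1) (i * s2 + j * t2)
      (i * s3 + j * t3) (i * s4 + j * t4)
      = i * form d s0 s1 s2 s3 s4 + j * form d t0 t1 t2 t3 t4.
    by rewrite /form; ring.
  by move=> [sa sb] [ta tb]; split; rewrite formD ?sa ?sb ?ta ?tb !mulr0 addr0.
have Tex (l : seq nat) : let d_ (d : 'I_5 -> K) i := d (inord (nth 0%N l i)) in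
    exists x y z : K, [/\ [|| x != 0, y != 0 | z != 0],
      d_ a 0%N * x + d_ a 1%N * y + d_ a 2%N * z = 0
    & d_ b 0%N * x + d_ b 1%N * y + d_ b 2%N * z = 0].
  have := common_zero3 (fun i => a (inord (nth 0%N l i))) (fun i => b (inord (nth 0%N l i))).
  by rewrite !inordK.
have [t2 [t3 [t4 [t_neq0 ta tb]]]] := Tex [:: 2; 3; 4]%N.
have {ta tb} Tt : T 0 0 t2 t3 t4.
  by split; [rewrite -[RHS]ta | rewrite -[RHS]tb]; rewrite /form /=; ring.
have [s0 [s1 [s2 [s_neq0 sa sb]]]] := Tex [:: 0; 1; 2]%N.
have {sa sb} Ts : T s0 s1 s2 0 0.
  by split; [rewrite -[RHS]sa | rewrite -[RHS]sb]; rewrite /form /=; ring.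
have sq0 (x : K) : x ^+ 2 = 0 -> x = 0 by move/eqP; rewrite expf_eq0 => /andP[_ /eqP].
have cube0 (x : K) : x ^+ 3 = 0 -> x = 0 by move/eqP; rewrite expf_eq0 => /andP[_ /eqP].
have t2_0 : t2 = 0.
  by apply: cube0; apply: oppr_inj; rewrite oppr0 -(vanish _ _ _ _ _ Tt) /hankel; ring.
have s2_0 : s2 = 0.
  by apply: cube0; apply: oppr_inj; rewrite oppr0 -(vanish _ _ _ _ _ Ts) /hankel; ring.
rewrite {}t2_0 {}s2_0 in Tt Ts t_neq0 s_neq0.
(* At [i s + t] the Hankel determinant is [- i (s0 t3^2 + i s1^2 t4)]. The two nonzero scalars 1 and
   [c] then make both terms vanish separately. *)
have hk i : s0 * t3 ^+ 2 + i * (s1 ^+ 2 * t4) = 0 \/ i = 0.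
  have [->|i0] := eqVneq i 0; [by right | left; apply: (mulfI i0)].
  apply: oppr_inj; rewrite mulr0 oppr0.
  rewrite -(vanish _ _ _ _ _ (Tlin i 1 _ _ _ _ _ _ _ _ _ _ Ts Tt)).
  rewrite /hankel; ring.
have hk1 : s0 * t3 ^+ 2 + s1 ^+ 2 * t4 = 0.
  by have [|/eqP] := hk 1; [rewrite mul1r | rewrite oner_eq0].
have s1t4 : s1 ^+ 2 * t4 = 0.
  have [hkc|/eqP] := hk c; last by rewrite (negbTE c0).
  have : (c - 1) * (s1 ^+ 2 * t4) = 0.
    by rewrite -(subr0 0) -[X in _ = X - _]hkc -[X in _ = _ - X]hk1; ring.
  by move/eqP; rewrite mulf_eq0 subr_eq0 (negbTE c1) => /eqP.
have s0t3 : s0 * t3 ^+ 2 = 0 by rewrite -hk1 s1t4 addr0.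
move/eqP: s1t4; rewrite mulf_eq0 expf_eq0 /= => /orP[] /eqP z0;
  rewrite {}z0 in Tt Ts t_neq0 s_neq0.
- rewrite eqxx !orbF in s_neq0; move/eqP: s0t3.
  rewrite mulf_eq0 (negbTE s_neq0) expf_eq0 /= => /eqP t3_0.
  rewrite {}t3_0 eqxx /= in Tt t_neq0.
  have [z1 [z2 [z3 [z_neq0 za zb]]]] := Tex [:: 1; 2; 3]%N.
  have {za zb} Tz : T 0 z1 z2 z3 0.
    by split; [rewrite -[RHS]za | rewrite -[RHS]zb]; rewrite /form /=; ring.
  (* Adding multiples of the coordinate vectors 0 and 4 changes these two coordinates at will, so
     the coefficients [- z3^2 + z2 j] of [i] and [- z1^2 + z2 i] of [j] can be tested at chosen
     values. *)
  have hz i j : hankel i z1 z2 z3 j = 0.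
    rewrite -(vanish _ _ _ _ _ (Tlin 1 1 _ _ _ _ _ _ _ _ _ _ Tz
      (Tlin (i / s0) (j / t4) _ _ _ _ _ _ _ _ _ _ Ts Tt))).
    by congr hankel; field; rewrite ?s_neq0 ?t_neq0.
  have z3_0 : z3 = 0.
    apply: sq0.
    by rewrite -(subr0 0) -[X in _ = X - _](hz 0 0) -[X in _ = _ - X](hz 1 0) /hankel; ring.
  have z1_0 : z1 = 0.
    apply: sq0.
    by rewrite -(subr0 0) -[X in _ = X - _](hz 0 0) -[X in _ = _ - X](hz 0 1) /hankel; ring.
  have z2_0 : z2 = 0.
    apply: cube0; apply: oppr_inj; rewrite oppr0 -(hz 0 0) z1_0 z3_0 /hankel; ring.
  by move: z_neq0; rewrite z1_0 z2_0 z3_0 !eqxx.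
- rewrite eqxx /= orbF in t_neq0; move/eqP: s0t3.
  rewrite mulf_eq0 expf_eq0 /= (negbTE t_neq0) orbF => /eqP s0_0.
  rewrite {}s0_0 eqxx /= orbF in Ts s_neq0.
  have [z0 [z2 [z4 [z_neq0 za zb]]]] := Tex [:: 0; 2; 4]%N.
  have {za zb} Tz : T z0 0 z2 0 z4.
    by split; [rewrite -[RHS]za | rewrite -[RHS]zb]; rewrite /form /=; ring.
  have hz i j : hankel z0 i z2 j z4 = 0.
    rewrite -(vanish _ _ _ _ _ (Tlin 1 1 _ _ _ _ _ _ _ _ _ _ Tz
      (Tlin (i / s1) (j / t3) _ _ _ _ _ _ _ _ _ _ Ts Tt))).
    by congr hankel; field; rewrite ?s_neq0 ?t_neq0.
  have z4_0 : z4 = 0.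
    by rewrite -(subr0 0) -[X in _ = X - _](hz 0 0) -[X in _ = _ - X](hz 1 0) /hankel; ring.
  have z0_0 : z0 = 0.
    by rewrite -(subr0 0) -[X in _ = X - _](hz 0 0) -[X in _ = _ - X](hz 0 1) /hankel; ring.
  have z2_0 : z2 = 0.
    apply: cube0; apply: oppr_inj; rewrite oppr0 -(hz 0 0) z0_0 z4_0 /hankel; ring.
  by move: z_neq0; rewrite z0_0 z2_0 z4_0 !eqxx.
Qed.

Lemma nf5_not_specializes_nf4 (c : K) : c != 0 -> c != 1 ->
  ~ specializes (nf4 K) (nf5 K).
Proof.
move=> c0 c1 [M [k [_ eq_nf]]].
(* If p = (x, x - 1, x^2 - x) then p_0 p_2 = p_0 p_1 + p_1 p_2, the relation of
   nf5; t lists the entries of p p^T with x^k replaced by h_k, and sub d is the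
   form d in the coordinates h. *)
pose sub (d : 'I_5 -> K) (i : 'I_5) : K :=
  let d' k := d (inord k) in
  [:: d' 1%N; - d' 1%N *+ 2 - d' 3%N + d' 4%N;
      d' 0%N + d' 1%N + d' 2%N + d' 3%N - d' 4%N *+ 2;
      - d' 2%N *+ 2 + d' 4%N; d' 2%N]`_i.
(* Every term of [nf4] contains y_2 or y_3, the variables at positions 1 and 2, so [nf4] vanishes
   wherever the forms in these two rows of [M] do. *)
apply: (@hankel_not_in_two_forms c (sub (M (inord 1))) (sub (M (inord 2))) c0 c1).
move=> h0 h1 h2 h3 h4; rewrite /sub !inordK //= => form1 form2.
pose t (i : 'I_5) :=
  [:: h2; h2 - h1 *+ 2 + h0; h4 - h3 *+ 2 + h2; h2 - h1; h3 - h2 *+ 2 + h1]`_i.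
have L1 : \sum_j M (inord 1) j * t j = 0.
  rewrite -[RHS]form1 big_ord_inord !big_nat_recr //= big_nil add0r /t !inordK //=; ring.
have L2 : \sum_j M (inord 2) j * t j = 0.
  rewrite -[RHS]form2 big_ord_inord !big_nat_recr //= big_nil add0r /t !inordK //=; ring.
have := congr1 (mmap idfun t) eq_nf.
rewrite nf5_eval mmapZ mmap_msubst nf4_eval /= L1 L2 !mulr0 !subr0 mulr0.
(* The entries of [p] form a basis of the polynomials of degree at most 2, with transition
   determinant 1 from the monomials, so [nf5] at [t] is exactly [hankel]. *)
by rewrite /t !inordK //= => <-; rewrite /hankel; ring.
Qed.

End NonEquivalence.

(** * Relations read off a normalized matrix *)

Section NormalizedMatrix.
Variables (K : fieldType) (E : finType) (W : {vspace {ffun E -> K^o}}) (m : nat).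
Variables (s : 'I_(3 + m) -> E) (A : 'M[K]_(3, m)).
Local Notation V := {ffun E -> K^o}.
Local Infix "**" := hadamard (at level 40).

Lemma normalized_rank3_basis : normalized_rank3 W s A ->
  exists u v w : V, [/\ basis_of W [tuple u; v; w],
    forall i j, tnth [tuple u; v; w] i (s (lshift m j)) = (i == j)%:R
  & forall i j, tnth [tuple u; v; w] i (s (rshift 3 j)) = A i j].
Proof.
move=> [_ _ [_ [w Ww wE]]]; have [u0 [u1 [u2 def_w]]] := basis_triple w.
rewrite def_w in Ww wE; exists u0, u1, u2; split=> // i j; rewrite -wE.
  by rewrite row_mxEl mxE.
by rewrite row_mxEr.
Qed.

Section Relations.
Variables u v w : V.
Hypothesis s_bij : bijective s.
Hypothesis uvw_l : forall i j, tnth [tuple u; v; w] i (s (lshift m j)) = (i == j)%:R.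
Hypothesis uvw_r : forall i j, tnth [tuple u; v; w] i (s (rshift 3 j)) = A i j.

Lemma uvw_rE j : [/\ u (s (rshift 3 j)) = A (inord 0) j,
  v (s (rshift 3 j)) = A (inord 1) j & w (s (rshift 3 j)) = A (inord 2) j].
Proof. by split; rewrite -uvw_r (tnth_nth 0) inordK. Qed.

(** Mixed products vanish on the identity block, so a relation between them only has to be checked
    on the columns of [A]. *)
Lemma cross_relation a b c :
  (a *: (v ** w) + b *: (u ** w) + c *: (u ** v) = 0) <->
  (forall j, a * (A (inord 1) j * A (inord 2) j) + b * (A (inord 0) j * A (inord 2) j)
           + c * (A (inord 0) j * A (inord 1) j) = 0).
Proof.
split=> [/ffunP rel j|rel].
  have := rel (s (rshift 3 j)); rewrite !ffunE /GRing.scale /=.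
  by have [-> -> ->] := uvw_rE j.
have [s' s'K sK] := s_bij.
apply/ffunP=> x; rewrite -(sK x); case: (split_ordP (s' x)) => j ->.
  have crossE y : y \in cross u v w -> y (s (lshift m j)) = 0 :> K.
    by move=> y_in; apply: (cross_eval uvw_l); apply: memv_span.
  rewrite !ffunDE !ffunZE (crossE (v ** w)) ?(crossE (u ** w)) ?(crossE (u ** v));
    do ?by rewrite !inE eqxx ?orbT.
  by rewrite !mulr0 !addr0 ffunE.
rewrite !ffunE /GRing.scale /=; have [-> -> ->] := uvw_rE j; exact: rel.
Qed.

End Relations.

Variable f : {mpoly K[#|E|]}.
Hypotheses (psif : is_psi W f) (norm : normalized_rank3 W s A).

Let Bij : bijective s. Proof. by case: norm => _ _ []. Qed.
Let dimH : \dim (hadamard_sq W) = #|E|. Proof. by case: norm. Qed.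

Lemma nf2_of_matrix : #|E| = 4%N ->
  (exists i, forall j, A i j = 0) -> pullback_of (nf2 K) f.
Proof.
move=> E4 [i Ai]; have [u [v [w [Wuvw l r]]]] := normalized_rank3_basis norm.
have d4 := dimH; rewrite E4 in d4; have [z zP] := cross_dim4 Wuvw l d4.
have rel a b c := (cross_relation Bij l r a b c).2.
have rel0 : u ** v = 0 \/ v ** w = 0.
  move: i Ai; apply: forall_ord3 => Ai.
  - by left; have := rel 0 0 1; rewrite !scale0r !add0r scale1r; apply=> j; rewrite Ai; ring.
  - by left; have := rel 0 0 1; rewrite !scale0r !add0r scale1r; apply=> j; rewrite Ai; ring.
  - by right; have := rel 1 0 0; rewrite !scale0r !addr0 scale1r; apply=> j; rewrite Ai; ring.
by apply: (nf2_of_zero psif Wuvw d4 zP); case: rel0; [constructor 3 | constructor 1].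
Qed.

Lemma nf3_of_matrix : #|E| = 4%N -> 
  (exists j, forall i, A i j <> 0) -> pullback_of (nf3 K) f.
Proof.
move=> E4 [j Aj]; have [u [v [w [Wuvw l r]]]] := normalized_rank3_basis norm.
have d4 := dimH; rewrite E4 in d4; have [z zP] := cross_dim4 Wuvw l d4.
have [uj vj wj] := uvw_rE r j.
have nz (x y : V) : x (s (rshift 3 j)) <> 0 -> y (s (rshift 3 j)) <> 0 -> x ** y != 0.
  move=> /eqP x0 /eqP y0; apply/eqP => /ffunP/(_ (s (rshift 3 j))); rewrite hadamardE ffunE.
  by move/eqP; rewrite mulf_eq0 (negbTE x0) (negbTE y0).
by apply: (nf3_criterion psif Wuvw d4 zP); apply: nz; rewrite ?uj ?vj ?wj.
Qed.

Section Relation5.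
Variables a b c : K.
Hypothesis E5 : #|E| = 5%N.
Hypothesis rel : forall j,
  a * (A (inord 1) j * A (inord 2) j) + b * (A (inord 0) j * A (inord 2) j)
  + c * (A (inord 0) j * A (inord 1) j) = 0.

Lemma nf4_of_matrix : [|| a != 0, b != 0 | c != 0] ->
  [|| a == 0, b == 0 | c == 0] -> pullback_of (nf4 K) f.
Proof.
have [u [v [w [Wuvw l r]]]] := normalized_rank3_basis norm.
have d5 := dimH; rewrite E5 in d5.
exact: (nf4_of_relation psif Wuvw d5 ((cross_relation Bij l r a b c).2 rel)).
Qed.

Lemma nf5_of_matrix : a != 0 -> b != 0 -> c != 0 -> pullback_of (nf5 K) f.
Proof.
have [u [v [w [Wuvw l r]]]] := normalized_rank3_basis norm.
have d5 := dimH; rewrite E5 in d5.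
exact: (nf5_criterion psif Wuvw d5 ((cross_relation Bij l r a b c).2 rel)).
Qed.

End Relation5.

Lemma matrix_relation5 : #|E| = 5%N ->
  exists a b c, [|| a != 0, b != 0 | c != 0] /\ forall j,
    a * (A (inord 1) j * A (inord 2) j) + b * (A (inord 0) j * A (inord 2) j)
    + c * (A (inord 0) j * A (inord 1) j) = 0.
Proof.
move=> E5; have [u [v [w [Wuvw l r]]]] := normalized_rank3_basis norm.
have d5 := dimH; rewrite E5 in d5.
have [a [b [c [nz rel]]]] := cross_dim5 Wuvw l d5.
by exists a, b, c; split=> //; apply/(cross_relation Bij l r a b c).
Qed.

End NormalizedMatrix.

(** * Linear dependence of the pair vectors *)

Section PairVectors.
Variables (K : fieldType) (A : 'M[K]_(3, 2)).

Lemma pair_vecE k :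
  [/\ pair_vec A (inord 0) k 0 = A (inord 1) k * A (inord 2) k,
      pair_vec A (inord 1) k 0 = A (inord 0) k * A (inord 2) k
    & pair_vec A (inord 2) k 0 = A (inord 0) k * A (inord 1) k].
Proof.
by split; rewrite mxE big_mkcond big_ord3 /= -!val_eqE /= !inordK //= ?mul1r ?mulr1.
Qed.

Lemma free_pair (vT : vectType K) (x y : vT) :
  reflect (forall a b : K, a *: x + b *: y = 0 -> a = 0 /\ b = 0) (free [:: x; y]).
Proof.
apply: (iffP (@freeP _ _ _ (in_tuple [:: x; y]))) => free_xy.
  move=> a b ab; pose k (i : 'I_2) := [:: a; b]`_i.
  have k0 := free_xy k; rewrite !big_ord_recl big_ord0 addr0 in k0.
  by have {}k0 := k0 ab; split; [apply: (k0 0) | apply: (k0 1)].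
move=> k; rewrite !big_ord_recl big_ord0 addr0 => /free_xy[k0 k1].
by case=> [[|[|//]] i_lt]; [rewrite -[RHS]k0 | rewrite -[RHS]k1]; congr k; apply: val_inj.
Qed.

End PairVectors.
Section DependentPairs.
Variables (K : fieldType) (A : 'M[K]_(3, 2)).

Let relation a b c := forall j,
  a * (A (inord 1) j * A (inord 2) j) + b * (A (inord 0) j * A (inord 2) j)
  + c * (A (inord 0) j * A (inord 1) j) = 0.

Lemma relation_pair_vec (k : 'I_3 -> K) :
  relation (k (inord 0)) (k (inord 1)) (k (inord 2)) <->
  \sum_t k t *: pair_vec A t = 0.
Proof.
rewrite big_ord3 /=.
have addE (x y : 'cV[K]_2) i : (x + y) i 0 = x i 0 + y i 0 by rewrite mxE.
have scaleE e (x : 'cV[K]_2) i : (e *: x) i 0 = e * x i 0 by rewrite mxE.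
split=> [rel|/colP rel j];
  [apply/colP=> j; rewrite [RHS]mxE | have := rel j; rewrite [RHS]mxE];
  rewrite !addE !scaleE; by have [-> -> ->] := pair_vecE A j.
Qed.

(** The coefficients of a dependence between two of the vectors, extended by 0 at the third index,
    form the relation. *)
Lemma relation_of_dependent_pair : (0 < #|dependent_pairs A|)%N ->
  exists a b c, [/\ relation a b c, [|| a != 0, b != 0 | c != 0]
    & [|| a == 0, b == 0 | c == 0]].
Proof.
case/card_gt0P=> -[p q]; rewrite inE /= => /andP[lt_pq /free_pair not_free].
have [k1 [k2 [rel nz]]] : exists k1 k2 : K,
    k1 *: pair_vec A p + k2 *: pair_vec A q = 0 /\ (k1 != 0) || (k2 != 0).
  apply: contrapT => no_rel; apply: not_free => k1 k2 rel.
  apply: contrapT => nz; apply: no_rel; exists k1, k2; split=> //.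
  by apply: contra_notT nz; rewrite negb_or !negbK => /andP[/eqP-> /eqP->].
have neq_pq : p != q by rewrite neq_ltn lt_pq.
pose k t := if t == p then k1 else if t == q then k2 else 0.
have kq : k q = k2 by rewrite /k eqxx eq_sym (negbTE neq_pq).
have kp : k p = k1 by rewrite /k eqxx.
exists (k (inord 0)), (k (inord 1)), (k (inord 2)); split.
- apply/relation_pair_vec; rewrite (bigD1 p) //= (bigD1 q) 1?eq_sym //= addrA kp kq rel.
  rewrite add0r big1 // => t /andP[tp tq].
  by rewrite /k (negbTE tp) (negbTE tq) scale0r.
- apply: contraTT nz; rewrite !negb_or !negbK => /and3P[/eqP k0 /eqP k1' /eqP k2'].
  have k_0 t : k t = 0 by move: t; apply: forall_ord3.
  by rewrite -kp -kq !k_0 eqxx.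
- apply: contraT; rewrite !negb_or => /and3P[k0 k1' k2'].
  have k_n0 t : k t != 0 by move: t; apply: forall_ord3.
  have : (#|'I_3| <= #|[set p; q]|)%N.
    apply/subset_leq_card/fintype.subsetP => t _; rewrite !inE; apply: contraR (k_n0 t).
    by rewrite negb_or /k => /andP[/negbTE-> /negbTE->].
  by rewrite card_ord cards2 neq_pq.
Qed.

(** A zero coefficient would leave a nontrivial relation between only two of the vectors. *)
Lemma relation_of_independent_pairs a b c : dependent_pairs A = finset.set0 ->
  relation a b c -> [|| a != 0, b != 0 | c != 0] -> [/\ a != 0, b != 0 & c != 0].
Proof.
move=> indep rel.
have free_pq (p q : 'I_3) : (p < q)%N -> free [:: pair_vec A p; pair_vec A q].
  move=> lt_pq; have /setP/(_ (p, q)) := indep.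
  by rewrite !inE /= lt_pq /= => /negbFE.
pose k (i : 'I_3) := [:: a; b; c]`_i.
have := (relation_pair_vec k).1; rewrite /k !inordK //= => /(_ rel).
rewrite big_ord3 !inordK //= => {}rel.
have [f12 f02 f01] : [/\ free [:: pair_vec A (inord 1); pair_vec A (inord 2)],
    free [:: pair_vec A (inord 0); pair_vec A (inord 2)]
  & free [:: pair_vec A (inord 0); pair_vec A (inord 1)]].
  by split; apply: free_pq; rewrite !inordK.
have [a0|a0] := eqVneq a 0.
  move: rel; rewrite a0 scale0r add0r => /(free_pair _ _ f12)[-> ->].
  by rewrite eqxx.
have [b0|b0] := eqVneq b 0.
  by move: rel; rewrite b0 scale0r addr0 => /(free_pair _ _ f02)[/eqP]; rewrite (negbTE a0).
have [c0|//] := eqVneq c 0.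
by move: rel; rewrite c0 scale0r addr0 => /(free_pair _ _ f01)[/eqP]; rewrite (negbTE a0).
Qed.

End DependentPairs.

(** * Counting classes *)

Section Existence.
Variables (K : fieldType) (m : nat) (A : 'M[K]_(3, m)).
Local Notation V := {ffun 'I_(3 + m) -> K^o}.
Local Infix "**" := hadamard (at level 40).

(** [C] is a left inverse of the 3 by [m] matrix of mixed products on the columns of [A]. It
    certifies that these products have rank [m], so that [hadamard_sq W] fills the whole space. *)
Lemma normalized_rank3_exists (C : 'I_m -> 'I_3 -> K) :
  (forall i j, C i (inord 0) * (A (inord 1) j * A (inord 2) j)
             + C i (inord 1) * (A (inord 0) j * A (inord 2) j)
             + C i (inord 2) * (A (inord 0) j * A (inord 1) j) = (i == j)%:R) ->
  exists (W : {vspace V}) f, normalized_rank3 W id A /\ is_psi W f.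
Proof.
move=> CA.
pose u (i : 'I_3) : V := [ffun x => row_mx 1%:M A i x].
have u_l i j : u i (lshift m j) = (i == j)%:R by rewrite ffunE row_mxEl mxE.
have u_r i j : u i (rshift 3 j) = A i j by rewrite ffunE row_mxEr.
pose w := [tuple u (inord 0); u (inord 1); u (inord 2)].
have wE i : tnth w i = u i.
  by move: i; apply: forall_ord3; rewrite (tnth_nth 0) inordK.
have w_free : free w.
  apply/freeP => a /ffunP a0 i; have := a0 (lshift m i).
  rewrite sum_ffunE [RHS]ffunE (bigD1 i) //= ffunZE -(tnth_nth 0 w) wE u_l eqxx mulr1.
  rewrite big1 ?addr0 // => j ji.
  by rewrite ffunZE -(tnth_nth 0 w) wE u_l (negbTE ji) mulr0.
pose W := <<w>>%VS.
have Ww : basis_of W w by rewrite /basis_of eqxx.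
have dimW : \dim W = 3%N by rewrite (vector.size_basis Ww).
have w_l i j : tnth w i (lshift m j) = (i == j)%:R by rewrite wE u_l.
have dimH : \dim (hadamard_sq W) = (3 + m)%N.
  apply/eqP; rewrite eqn_leq; apply/andP; split.
    have := dimvS (subvf (hadamard_sq W)).
    by rewrite dimvf /dim /= card_ord muln1.
  rewrite (dim_hadamard_sq Ww w_l) leq_add2l.
  pose p := cross (u (inord 0)) (u (inord 1)) (u (inord 2)).
  pose D : m.-tuple V := [tuple \sum_t C i t *: p`_t | i < m].
  have D_eval i j : tnth D i (rshift 3 j) = (i == j)%:R.
    rewrite tnth_mktuple -CA big_ord3 /= !ffunDE !ffunZE !inordK //= !hadamardE.
    by rewrite !u_r.
  have D_free : free D.
    apply/freeP => a /ffunP a0 i; have := a0 (rshift 3 i).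
    rewrite sum_ffunE [RHS]ffunE (bigD1 i) //= ffunZE -(tnth_nth 0 D) D_eval eqxx mulr1.
    rewrite big1 ?addr0 // => j ji.
    by rewrite ffunZE -(tnth_nth 0 D) D_eval (negbTE ji) mulr0.
  rewrite -[X in (X <= _)%N](size_tuple D) -(eqP D_free); apply: dimvS.
  apply/span_subvP => x /tnthP[i ->]; rewrite tnth_mktuple.
  by apply: memv_suml => t _; apply/memvZ/memv_span/mem_nth.
exists W; have [f psif] : exists f, is_psi W f.
  by exists (config_poly (vbasis W)), (vbasis W); first exact: vbasisP.
exists f; split=> //; split; rewrite ?dimH ?card_ord //.
by split; [exists id | exists w => // i j; rewrite wE ffunE].
Qed.

End Existence.

Section Counting.
Variable K : fieldType.
Local Open Scope classical_set_scope.

Lemma Psi_pullback n (h : {mpoly K[n]}) (E : finType)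
    (W : {vspace {ffun E -> K^o}}) f m s (A : 'M_(3, m)) :
  @normalized_rank3 K E W m s A -> is_psi W f -> #|E| = n -> pullback_of h f ->
  exists2 g, Psi K 3 n g & pullback_of h (tagged g).
Proof.
move=> [dimW dimH _] psif En hf; exists (Tagged (fun n => {mpoly K[n]}) f) => //.
by exists E, W, f; split=> //; rewrite dimH.
Qed.

Lemma card_Psi_classes1 d n (h : {mpoly K[n]}) :
  (forall g, Psi K 3 d g -> pullback_of h (tagged g)) ->
  (exists2 g, Psi K 3 d g & pullback_of h (tagged g)) ->
  (Psi_classes K 3 d #= `I_1)%card.
Proof.
move=> all_h [g0 Psi_g0 hg0].
suff -> : Psi_classes K 3 d = [set Psi K 3 d] by apply: card_set1.
have classE f : Psi K 3 d f ->
    [set g | Psi K 3 d g /\ contact_equiv (tagged f) (tagged g)] = Psi K 3 d.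
  move=> Psi_f; apply/seteqP; split=> g /=; first by case.
  by move=> Psi_g; split=> //; apply: contact_equiv_pullback (all_h _ Psi_f) (all_h _ Psi_g).
apply/seteqP; split=> C /=; first by move=> [f Psi_f <-]; apply: classE.
by move=> ->; exists g0 => //; apply: classE.
Qed.

(** An equivalence between the two kinds of polynomials would give a chain of specializations from
    [h1] to [h2]. Excluding this one direction is enough because [contact_equiv] is symmetric. *)
Lemma card_Psi_classes2 d n1 n2 (h1 : {mpoly K[n1]}) (h2 : {mpoly K[n2]}) :
  ~ specializes h1 h2 ->
  (forall g, Psi K 3 d g -> pullback_of h1 (tagged g) \/ pullback_of h2 (tagged g)) ->
  (exists2 g, Psi K 3 d g & pullback_of h1 (tagged g)) ->
  (exists2 g, Psi K 3 d g & pullback_of h2 (tagged g)) ->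
  (Psi_classes K 3 d #= `I_2)%card.
Proof.
move=> no_spec h12 [g1 Psi_g1 h1g1] [g2 Psi_g2 h2g2].
have not_equiv (p q : polys K) : pullback_of h1 (tagged p) -> pullback_of h2 (tagged q) ->
    ~ contact_equiv (K := K) (tagged q) (tagged p).
  move=> /pullback_specializes[h1p _] /pullback_specializes[_ qh2].
  move=> /contact_equiv_specializes pq; apply: no_spec.
  exact: specializes_trans qh2 (specializes_trans pq h1p).
pose C n (h : {mpoly K[n]}) : set (polys K) :=
  [set g | Psi K 3 d g /\ pullback_of h (tagged g)].
pose cl (f : polys K) := [set g | Psi K 3 d g /\ contact_equiv (K := K) (tagged f) (tagged g)].
have cl1 (f : polys K) : pullback_of h1 (tagged f) -> cl f = C _ h1.
  move=> h1f; apply/seteqP; split=> g [Psi_g fg]; split=> //.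
    by case: (h12 g Psi_g) => // h2g; case: (not_equiv f g) => //; apply: contact_equiv_sym.
  exact: contact_equiv_pullback fg.
have cl2 (f : polys K) : pullback_of h2 (tagged f) -> cl f = C _ h2.
  move=> h2f; apply/seteqP; split=> g [Psi_g fg]; split=> //.
    by case: (h12 g Psi_g) => // h1g; case: (not_equiv g f).
  exact: contact_equiv_pullback fg.
have C12 : C _ h1 <> C _ h2.
  move=> eqC; have [_ h2g1] : C _ h2 g1 by rewrite -eqC.
  apply: (not_equiv g1 g1) => //; exact: (contact_equiv_pullback h2g1 h2g1).
apply/eq_cardSP; exists (C _ h1); first by exists g1; rewrite -?(cl1 g1).
suff -> : Psi_classes K 3 d `\ C _ h1 = [set C _ h2] by apply: card_set1.
apply/seteqP; split=> D /=.
  move=> [[f Psi_f <-] /= neq]; have [/cl1|/cl2 //] := h12 f Psi_f.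
  by move/neq.
move=> ->; split; last by move/esym.
by exists g2; rewrite -?(cl2 g2).
Qed.

End Counting.

(** * Matrices that realize the normal forms *)

Section Examples.
Variable K : fieldType.

Let mx m (s : seq (seq K)) : 'M[K]_(3, m) := \matrix_(i, j) (nth [::] s i)`_j.

Lemma nf1_occurs : exists2 g, Psi K 3 3 g & pullback_of (nf1 K) (tagged g).
Proof.
have [|W [f [norm psif]]] := @normalized_rank3_exists K 0 (mx 0 [::]) (fun _ _ => 0).
  by case.
have [dimW dimH _] := norm; rewrite card_ord in dimH.
by apply: (Psi_pullback norm psif); rewrite ?card_ord //; apply: (classify3 psif).
Qed.

Lemma nf2_occurs : exists2 g, Psi K 3 4 g & pullback_of (nf2 K) (tagged g).
Proof.
have [|W [f [norm psif]]] := @normalized_rank3_exists K 1 (mx 1 [:: [:: 1]; [:: 1]; [:: 0]])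
  (fun _ t => (t == inord 2)%:R).
  by move=> i j; rewrite !ord1 !mxE -!val_eqE /= !inordK //=; ring.
apply: (Psi_pullback norm psif); rewrite ?card_ord //; apply: (nf2_of_matrix psif norm).
  by rewrite card_ord.
by exists (inord 2) => j; rewrite ord1 mxE inordK.
Qed.

Lemma nf3_occurs : exists2 g, Psi K 3 4 g & pullback_of (nf3 K) (tagged g).
Proof.
have [|W [f [norm psif]]] := @normalized_rank3_exists K 1 (const_mx 1)
  (fun _ t => (t == inord 2)%:R).
  by move=> i j; rewrite !ord1 !mxE -!val_eqE /= !inordK //=; ring.
apply: (Psi_pullback norm psif); rewrite ?card_ord //; apply: (nf3_of_matrix psif norm).
  by rewrite card_ord.
by exists 0 => i; rewrite mxE; apply/eqP/oner_neq0.
Qed.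

Lemma nf4_occurs : exists2 g, Psi K 3 5 g & pullback_of (nf4 K) (tagged g).
Proof.
(* On these columns [v ** w] is 0, while [u ** v] and [u ** w] are the two unit vectors. *)
pose A := mx 2 [:: [:: 1; 1]; [:: 1; 0]; [:: 0; 1]].
have [|W [f [norm psif]]] := @normalized_rank3_exists K 2 A
  (fun i t => ((i == 0) && (t == inord 2) || (i == 1) && (t == inord 1))%:R).
  move=> i j; rewrite !mxE -!val_eqE /= !inordK //=.
  by case: i j => [[|[|//]] ?] [[|[|//]] ?] /=; ring.
apply: (Psi_pullback norm psif); rewrite ?card_ord //.
apply: (nf4_of_matrix (a := 1) (b := 0) (c := 0) psif norm);
  rewrite ?card_ord ?oner_neq0 ?eqxx ?orbT //.
by move=> j; rewrite !mxE !inordK //=; case: j => [[|[|//]] ?] /=; ring.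
Qed.

(* Two points of the conic [x z = x y + y z] in the coordinates
   [(x : y : z) = (t : t - 1 : t (t - 1))]. *)
Lemma nf5_occurs (t s : K) : t != s -> [/\ t != 0, t != 1, s != 0 & s != 1] ->
  exists2 g, Psi K 3 5 g & pullback_of (nf5 K) (tagged g).
Proof.
move=> ts [t0 t1 s0 s1].
have t1' : t - 1 != 0 by rewrite subr_eq0.
have s1' : s - 1 != 0 by rewrite subr_eq0.
have ts' : t - s != 0 by rewrite subr_eq0.
have st' : s - t != 0 by rewrite subr_eq0 eq_sym.
pose A := mx 2 [:: [:: t; s]; [:: t - 1; s - 1]; [:: t * (t - 1); s * (s - 1)]].
(* On the column of [t] the mixed products are [t (t - 1)] times (t - 1, t, 1). The entries 1 and
   [- s] therefore evaluate the Lagrange factor [x - s], and [tau] normalizes its value at [t];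
   [sigma] does the same with [t] and [s] exchanged. *)
pose tau := t * (t - 1) * (t - s); pose sigma := s * (s - 1) * (s - t).
have [|W [f [norm psif]]] := @normalized_rank3_exists K 2 A
  (fun i k => (nth [::] [:: [:: 0; tau^-1; - (s / tau)];
                            [:: 0; sigma^-1; - (t / sigma)]] i)`_k).
  move=> i j; rewrite !mxE -!val_eqE /= !inordK //= /tau /sigma.
  case: i j => [[|[|//]] ?] [[|[|//]] ?] /=; field; by rewrite ?t0 ?t1' ?s0 ?s1' ?ts' ?st'.
apply: (Psi_pullback norm psif); rewrite ?card_ord //.
apply: (nf5_of_matrix (a := 1) (b := -1) (c := 1) psif norm);
  rewrite ?card_ord ?oppr_eq0 ?oner_neq0 //.
by move=> j; rewrite !mxE !inordK //=; case: j => [[|[|//]] ?] /=; ring.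
Qed.

Lemma nf6_occurs : exists2 g, Psi K 3 6 g & pullback_of (nf6 K) (tagged g).
Proof.
(* Column [j] has its only zero in row [2 - j], so a single mixed product survives there, the one
   omitting that basis vector. The matrix of products is antidiagonal. *)
pose A := mx 3 [:: [:: 1; 1; 0]; [:: 1; 0; 1]; [:: 0; 1; 1]].
have [|W [f [norm psif]]] := @normalized_rank3_exists K 3 A
  (fun i t => (i + t == 2)%:R).
  move=> i j; rewrite !mxE -!val_eqE /= !inordK //=.
  by case: i j => [[|[|[|//]]] ?] [[|[|[|//]]] ?] /=; ring.
have [dimW dimH _] := norm; rewrite card_ord in dimH.
by apply: (Psi_pullback norm psif); rewrite ?card_ord //; apply: (classify6 psif).
Qed.

(** The parameters 0, 1 and infinity give the coordinate points of the conic, which leaves q - 2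
    usable points over a field with q elements. Two of them exist exactly when q is at least 4. *)
Lemma two_generic_elements : (exists s : seq K, uniq s /\ size s = 4%N) ->
  exists t s : K, t != s /\ [/\ t != 0, t != 1, s != 0 & s != 1].
Proof.
move=> [l [l_uniq l4]].
pose zo : seq K := [:: 0; 1].
have : (2 <= size [seq x <- l | x \notin zo])%N.
  have count_le : (count (mem zo) l <= 2)%N.
    rewrite -size_filter -[2%N]/(size zo); apply: uniq_leq_size; first exact: filter_uniq.
    by move=> x; rewrite mem_filter => /andP[].
  have := count_predC (mem zo) l; rewrite l4 size_filter => sz.
  by rewrite -(leq_add2l (count (mem zo) l)) sz (leq_add count_le (leqnn 2)).
case E : [seq x <- l | _] => [|t [|s r]] // _.
have := filter_uniq [pred x | x \notin zo] l_uniq.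
rewrite [filter _ _]E /= inE negb_or => /andP[/andP[ts _] _].
have in_l x : x \in [:: t, s & r] -> x != 0 /\ x != 1.
  by rewrite -E mem_filter !inE negb_or => /andP[/andP[]].
exists t, s; split=> //.
have [|t0 t1] := in_l t; first by rewrite inE eqxx.
by have [|s0 s1] := in_l s; first by rewrite !inE eqxx orbT.
Qed.

End Examples.

Theorem proposition7p3 (K : fieldType) :
  (* numbers of equivalence classes *)
  [/\ (Psi_classes K 3 3 #= `I_1)%card,
      (Psi_classes K 3 4 #= `I_2)%card,
      (* false over the fields with 2 and 3 elements, where only (iv) occurs *)
      (exists s : seq K, uniq s /\ size s = 4%N) ->
        (Psi_classes K 3 5 #= `I_2)%card
    & (Psi_classes K 3 6 #= `I_1)%card] /\
  (* (i) *)
  (forall (E : finType) (W : {vspace {ffun E -> K^o}})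
     (s : 'I_(3 + 0) -> E) (A' : 'M[K]_(3, 0)) (f : {mpoly K[#|E|]}),
     #|E| = 3%N -> normalized_rank3 W s A' -> is_psi W f ->
     contact_equiv f (nf1 K)) /\
  (* (ii) *)
  (forall (E : finType) (W : {vspace {ffun E -> K^o}})
     (s : 'I_(3 + 1) -> E) (A' : 'M[K]_(3, 1)) (f : {mpoly K[#|E|]}),
     #|E| = 4%N -> normalized_rank3 W s A' -> is_psi W f ->
     (exists! i, A' i 0 = 0) ->
     contact_equiv f (nf2 K)) /\
  (* (iii) *)
  (forall (E : finType) (W : {vspace {ffun E -> K^o}})
     (s : 'I_(3 + 1) -> E) (A' : 'M[K]_(3, 1)) (f : {mpoly K[#|E|]}),
     #|E| = 4%N -> normalized_rank3 W s A' -> is_psi W f ->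
     (forall i, A' i 0 <> 0) ->
     contact_equiv f (nf3 K)) /\
  (* (iv) *)
  (forall (E : finType) (W : {vspace {ffun E -> K^o}})
     (s : 'I_(3 + 2) -> E) (A' : 'M[K]_(3, 2)) (f : {mpoly K[#|E|]}),
     #|E| = 5%N -> normalized_rank3 W s A' -> is_psi W f ->
     #|dependent_pairs A'| = 1%N ->
     contact_equiv f (nf4 K)) /\
  (* (v) *)
  (forall (E : finType) (W : {vspace {ffun E -> K^o}})
     (s : 'I_(3 + 2) -> E) (A' : 'M[K]_(3, 2)) (f : {mpoly K[#|E|]}),
     #|E| = 5%N -> normalized_rank3 W s A' -> is_psi W f ->
     dependent_pairs A' = finset.set0 ->
     contact_equiv f (nf5 K)) /\
  (* (vi) *)
  (forall (E : finType) (W : {vspace {ffun E -> K^o}})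
     (s : 'I_(3 + 3) -> E) (A' : 'M[K]_(3, 3)) (f : {mpoly K[#|E|]}),
     #|E| = 6%N -> normalized_rank3 W s A' -> is_psi W f ->
     contact_equiv f (nf6 K)) /\
  (* the list is complete *)
  (forall (E : finType) (W : {vspace {ffun E -> K^o}}) (m : nat)
     (s : 'I_(3 + m) -> E) (A' : 'M[K]_(3, m)) (f : {mpoly K[#|E|]}),
     normalized_rank3 W s A' -> is_psi W f ->
     contact_equiv f (nf1 K) \/ contact_equiv f (nf2 K) \/
     contact_equiv f (nf3 K) \/ contact_equiv f (nf4 K) \/
     contact_equiv f (nf5 K) \/ contact_equiv f (nf6 K)).
Proof.
have cl4 (g : polys K) : Psi K 3 4 g ->
    pullback_of (nf2 K) (tagged g) \/ pullback_of (nf3 K) (tagged g).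
  by move=> [E [W [f [dimW dimH psif ->]]]]; apply: (classify4 psif).
have cl5 (g : polys K) : Psi K 3 5 g ->
    pullback_of (nf4 K) (tagged g) \/ pullback_of (nf5 K) (tagged g).
  by move=> [E [W [f [dimW dimH psif ->]]]]; apply: (classify5 psif).
have equiv m n (f : {mpoly K[m]}) (h : {mpoly K[n]}) :
    pullback_of h f -> contact_equiv f h.
  by move=> hf; apply: contact_equiv_pullback hf (pullback_of_refl h).
split; [split | split; [|split; [|split; [|split; [|split; [|split]]]]]].
- apply: card_Psi_classes1 (nf1_occurs K).
  by move=> g [E [W [f [dimW dimH psif ->]]]]; apply: (classify3 psif).
- exact: card_Psi_classes2 (@nf3_not_specializes_nf2 K) cl4 (nf2_occurs K) (nf3_occurs K).
- move=> /two_generic_elements[t [s [ts nz]]]; have [t0 t1 _ _] := nz.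
  (* The parameter [t] of a point on the conic also serves as the scalar other than 0 and 1 in the
     Hankel argument. *)
  exact: card_Psi_classes2 (nf5_not_specializes_nf4 t0 t1) cl5
           (nf4_occurs K) (nf5_occurs ts nz).
- apply: card_Psi_classes1 (nf6_occurs K).
  by move=> g [E [W [f [dimW dimH psif ->]]]]; apply: (classify6 psif).
- move=> E W s A f cardE [dimW dimH _] psif; rewrite cardE in dimH.
  by apply: equiv; apply: (classify3 psif).
- move=> E W s A f cardE norm psif [i [Ai _]]; apply: equiv.
  by apply: (nf2_of_matrix psif norm cardE); exists i => j; rewrite ord1.
- move=> E W s A f cardE norm psif A_neq0; apply: equiv.
  by apply: (nf3_of_matrix psif norm cardE); exists 0.
- move=> E W s A f cardE norm psif dep; apply: equiv.
  have [|a [b [c [rel nz z]]]] := @relation_of_dependent_pair K A; first by rewrite dep.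
  exact: (nf4_of_matrix psif norm cardE rel nz z).
- move=> E W s A f cardE norm psif indep; apply: equiv.
  have [a [b [c [nz rel]]]] := matrix_relation5 norm cardE.
  have [a0 b0 c0] := relation_of_independent_pairs indep rel nz.
  exact: (nf5_of_matrix psif norm cardE rel a0 b0 c0).
- move=> E W s A f cardE [dimW dimH _] psif; rewrite cardE in dimH.
  by apply: equiv; apply: (classify6 psif).
- move=> E W m s A f norm psif; have [dimW dimH _] := norm.
  have [u [v [w [Wuvw l _]]]] := normalized_rank3_basis norm.
  have /andP[d3] := dim_hadamard_sq_bounds Wuvw l.
  rewrite leq_eqVlt ltnS leq_eqVlt ltnS leq_eqVlt ltnS leq_eqVlt ltnNge d3 orbF.
  case/or4P=> /eqP d.
  + by do 5!right; apply: equiv; apply: (classify6 psif).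
  + by do 3!right; have [/equiv|/equiv] := classify5 psif dimW d; [left | right; left].
  + by right; have [/equiv|/equiv] := classify4 psif dimW d; [left | right; left].
  + by left; apply: equiv; apply: (classify3 psif).
Qed.
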